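(* Let $\Gamma$ be a finitely generated group that admits a descending chain $\Gamma_0\supseteq\Gamma_1\supseteq\Gamma_2\supseteq\dots$ of finite-index normal subgroups of $\Gamma$ such that $\Gamma_n\cong\Gamma$ for all $n$ and $\bigcap_n \Gamma_n$ is finite. Then $\Gamma$ is virtually abelian.
   Context: A group is virtually abelian if it has a finite-index abelian subgroup. *)

(* Defs.v *)
From mathcomp Require Import all_boot.
From mathcomp Require Import monoid.
From mathcomp Require Import boolp classical_sets functions cardinality.

Set Implicit Arguments.
Unset Strict Implicit.
Unset Printing Implicit Defensive.

Local Open Scope classical_set_scope.
Local Open Scope group_scope.

Definition subgroup (G : groupType) (H : set G) : Prop := group_closed (mem H).

Definition normal_subgroup (G : groupType) (H : set G) : Prop :=
  subgroup H /\ forall x g : G, H x -> H (x ^ g).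

Definition left_coset (G : groupType) (H : set G) (x : G) : set G :=
  [set x * h | h in H].

Definition finite_index (G : groupType) (H : set G) : Prop :=
  finite_set (range (left_coset H)).

(* [f] is a total function, but only its values on [H] matter. *)
Definition isomorphic (G1 G2 : groupType) (H : set G1) (K : set G2) : Prop :=
  exists2 f : G1 -> G2, set_bij H K f & {in H &, {morph f : x y / x * y}}.

Definition finitely_generated (G : groupType) : Prop :=
  exists2 S : set G, finite_set S & smallest (@subgroup G) S = [set: G].

Definition virtually_abelian (G : groupType) : Prop :=
  exists H : set G,
    [/\ subgroup H, finite_index H & {in H &, forall x y, commute x y}].

(* Main.v *)
(* Write Gamma_n = phi_n(G) with phi_n : G -> G injective.
   - If phi : G -> G is injective with a normal image L of finite index, then G / L has a series
     of subgroups, central in G (in particular it is nilpotent).  For characteristic subgroups M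
     of finite index, all the sections M / phi(M) have the order q = [G : L].  The product tau of
     the orders of the central factors of a section, for the action of phi^k(G), is multiplicative
     in the section, increasing in k and invariant under phi; comparing M / phi(M), L / phi(M) and
     G / M forces tau = q on G / L.
   - The centralisers of M / phi_n(M) have index bounded independently of n, and a finitely
     generated group has finitely many subgroups of bounded index, so such a subgroup contains
     a fixed Gamma_{n0} once it contains some Gamma_m.  This gives
     [phi_n x, g] \in phi_n(G') for all g in Gamma_{n0}, which yields additive maps from
     Gamma_{n0} to the powers of G' / [G', G].  Since these groups have finite torsion, the same
     bounded index argument shows that for some n the commutators of G lie in
     [G', G] phi_n^-1(Gamma_m) for all m >= n.
   - Since G / phi_n^-1(Gamma_m) is nilpotent, G' is contained in phi_n^-1(Gamma_m): the
     commutators of Gamma_n lie in the finite intersection of the chain.  As Gamma_n is finitely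
     generated, its centre has finite index. *)
Require Import Defs.
From HB Require Import structures.
From mathcomp Require Import all_boot all_algebra all_fingroup.
From mathcomp Require Import monoid.
From mathcomp Require Import boolp classical_sets functions cardinality.

Set Implicit Arguments.
Unset Strict Implicit.
Unset Printing Implicit Defensive.

(** * Subgroups and their indices *)

Ltac gnorm := rewrite ?(commgEl, conjgE);
  rewrite ?(invgM, invgK, mulgA, mulgK, mulgVK, mulgV, mulVg, mul1g, mulg1, invg1).

Section Subgroups.
Variable G : groupType.
Local Open Scope classical_set_scope.
Local Open Scope group_scope.
Implicit Types (A B C H K Y : set G) (x y z : G).

Lemma subgroupI H : H 1 -> (forall x y, H x -> H y -> H (x * y^-1)) -> subgroup H.
Proof.
move=> H1 HD; split; first exact/mem_set.
by move=> x y /set_mem Hx /set_mem Hy; apply/mem_set/HD.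
Qed.

Lemma subgroup1 H : subgroup H -> H 1.
Proof. by case=> /set_mem. Qed.

Lemma subgroupV H x : subgroup H -> H x -> H x^-1.
Proof. by move=> /group_closedV sH Hx; apply/set_mem/sH/mem_set. Qed.

Lemma subgroupM H x y : subgroup H -> H x -> H y -> H (x * y).
Proof. by move=> /group_closedM sH Hx Hy; apply/set_mem/sH; exact/mem_set. Qed.

Lemma subgroupX H x n : subgroup H -> H x -> H (x ^+ n).
Proof.
move=> sH Hx; elim: n => [|n IH]; first by rewrite expg0; apply: subgroup1.
by rewrite expgS; apply: subgroupM.
Qed.

Lemma subgroupMr H x y : subgroup H -> H y -> H (x * y) -> H x.
Proof. by move=> sH Hy Hxy; rewrite -(mulgK y x); apply: subgroupM => //; apply: subgroupV. Qed.

Lemma subgroupMl H x y : subgroup H -> H x -> H (x * y) -> H y.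
Proof. by move=> sH Hx Hxy; rewrite -(mulKg x y); apply: subgroupM => //; apply: subgroupV. Qed.

Lemma subgroupVl H x y : subgroup H -> H (x^-1 * y) -> H (y^-1 * x).
Proof. by move=> sH /(subgroupV sH); rewrite invgM invgK. Qed.

Lemma subgroupVt H x y z : subgroup H -> H (x^-1 * y) -> H (y^-1 * z) -> H (x^-1 * z).
Proof. by move=> sH h1 /(subgroupM sH h1); rewrite mulgA mulgK. Qed.

Lemma subgroupT : subgroup [set: G].
Proof. exact: subgroupI. Qed.

Lemma subgroupSI H K : subgroup H -> subgroup K -> subgroup (H `&` K).
Proof.
move=> sH sK; apply: subgroupI; first by split; apply: subgroup1.
by move=> x y [Hx Kx] [Hy Ky]; split; apply: subgroupM => //; apply: subgroupV.
Qed.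

Lemma left_coset_eq H x y : subgroup H -> left_coset H x = left_coset H y <-> H (x^-1 * y).
Proof.
move=> sH; split=> [xy|Hxy].
  have : left_coset H y y by exists 1; rewrite ?mulg1 //; apply: subgroup1.
  by rewrite -xy => -[h Hh <-]; rewrite mulKg.
apply/seteqP; split=> _ [h Hh <-].
  exists (y^-1 * x * h); last by rewrite -mulgA mulVKg.
  by apply: subgroupM => //; apply: subgroupVl.
by exists (x^-1 * y * h); [apply: subgroupM | rewrite -mulgA mulVKg].
Qed.

Definition mulset A B : set G := [set x | exists2 a, A a & exists2 b, B b & x = a * b].

Lemma mulsetl A B x : subgroup B -> A x -> mulset A B x.
Proof. by move=> sB Ax; exists x => //; exists 1; [apply: subgroup1 | rewrite mulg1]. Qed.

Lemma mulsetr A B x : subgroup A -> B x -> mulset A B x.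
Proof. by move=> sA Bx; exists 1; [apply: subgroup1 | exists x => //; rewrite mul1g]. Qed.

Lemma subgroup_mulset H Y : subgroup H -> normal_subgroup Y -> subgroup (mulset H Y).
Proof.
move=> sH [sY nY]; apply: subgroupI.
  by apply: mulsetl => //; apply: subgroup1.
move=> _ _ [a Ha [b Yb ->]] [c Hc [d Yd ->]].
exists (a * c^-1); first by apply: subgroupM => //; apply: subgroupV.
exists ((b * d^-1) ^ c^-1); first by apply: nY; apply: subgroupM => //; apply: subgroupV.
by rewrite conjgE !invgM !invgK !mulgA mulgVK.
Qed.

(** A left transversal indexed by ['I_n], so that indices multiply and compare without any quotient
    being formed. *)
Definition has_index A B n := exists t : 'I_n -> G,
  [/\ forall i, A (t i), forall x, A x -> exists i, B ((t i)^-1 * x) &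
      forall i j, B ((t i)^-1 * t j) -> i = j].

Lemma has_index_finType (I : finType) (t : I -> G) A B :
  (forall i, A (t i)) -> (forall x, A x -> exists i, B ((t i)^-1 * x)) ->
  (forall i j, B ((t i)^-1 * t j) -> i = j) -> has_index A B #|I|.
Proof.
move=> At Ac Ad; exists (fun i => t (enum_val i)); split => //.
  by move=> x /Ac[i Bi]; exists (enum_rank i); rewrite enum_rankK.
by move=> i j /Ad/enum_val_inj.
Qed.


(** The cosets inject into the labels once each coset has chosen a label of its own. Most index
    bounds below come from a suitable [f]. *)
Lemma has_index_label (I : finType) (f : G -> I) A B :
  (forall x y, A x -> A y -> f x = f y -> B (x^-1 * y)) -> subgroup B ->
  exists2 n, n <= #|I| & has_index A B n.
Proof.
move=> fB sB; pose Q x i := `[< exists2 y, A y & f y = i /\ B (x^-1 * y) >].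
(* Several labels may occur in one coset; [g] picks one of them in a way that depends on the coset
   only. *)
pose g x := [pick i | Q x i].
have gP x : A x -> exists2 i, g x = Some i & exists2 y, A y & f y = i /\ B (x^-1 * y).
  rewrite /g; case: pickP => [i /asboolP Qi|/(_ (f x)) + Ax]; first by exists i.
  move/asboolP => []; exists x => //; split => //.
  by rewrite mulVg; apply: subgroup1.
have gE x y : B (x^-1 * y) -> g x = g y.
  move=> Bxy; apply: eq_pick => i; apply/asboolP/asboolP => -[z Az [fz Bz]].
    by exists z => //; split => //; apply: subgroupVt Bz => //; apply: subgroupVl.
  by exists z => //; split => //; apply: subgroupVt Bz.
have gI x y : A x -> A y -> g x = g y -> B (x^-1 * y).
  move=> /gP[i -> [u Au [fu Bu]]] /gP[j -> [v Av [fv Bv]]] [ij].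
  apply: subgroupVt Bu _ => //; apply: (@subgroupVt _ _ v) => //; last exact: subgroupVl.
  by apply: fB => //; rewrite fu fv.
pose P i := `[< exists2 x, A x & g x = Some i >].
have ex (i : {i : I | P i}) : {x | A x & g x = Some (sval i)}.
  by apply: cid2; case: i => i /= /asboolP.
exists #|{: {i : I | P i}}|; first by rewrite card_sig max_card.
apply: (@has_index_finType _ (fun i => s2val (ex i))).
- by move=> i; case: (ex i).
- move=> x Ax; have [i gx _] := gP _ Ax.
  have Pi : P i by apply/asboolP; exists x.
  exists (exist (fun i => is_true (P i)) i Pi); case: (ex _) => y Ay /= gy.
  by apply: gI => //; rewrite gy gx.
- move=> i j; case: (ex i) => x Ax /= gx; case: (ex j) => y Ay /= gy /gE.
  by rewrite gx gy => -[] /val_inj.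
Qed.

Lemma has_index_leq A B m n : subgroup B ->
  has_index A B m -> has_index A B n -> m <= n.
Proof.
move=> sB [t [At _ td]] [u [_ uc _]].
have ex i : {j | B ((u j)^-1 * t i)} by apply: cid; apply: uc.
rewrite -[m]card_ord -[n]card_ord; apply: (@leq_card _ _ (fun i => sval (ex i))) => i i' ij.
apply: td; move: (svalP (ex i)) (svalP (ex i')); rewrite ij => Bi Bi'.
by apply: subgroupVt Bi' => //; apply: subgroupVl.
Qed.

Lemma has_index_uniq A B m n : subgroup B ->
  has_index A B m -> has_index A B n -> m = n.
Proof. 
move=> sB Am An; apply/eqP.
by rewrite eqn_leq (has_index_leq sB Am An) (has_index_leq sB An Am).
Qed.

Lemma has_index_gt0 A B n : subgroup A -> has_index A B n -> 0 < n.
Proof.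
move=> sA [t [_ tc _]]; have [i _] := tc _ (subgroup1 sA).
by case: n t tc i => // t _ [].
Qed.

Lemma has_index1 A : subgroup A -> has_index A A 1.
Proof.
move=> sA; exists (fun=> 1); split=> [_|x Ax|i j _]; first exact: subgroup1.
  by exists ord0; rewrite invg1 mul1g.
by rewrite !ord1.
Qed.

Lemma has_index1_sub A B : subgroup A -> subgroup B -> has_index A B 1 -> A `<=` B.
Proof.
move=> sA sB [t [_ tc _]] x Ax; have [i Bi] := tc _ (subgroup1 sA).
have [j Bj] := tc _ Ax; move: Bi Bj; rewrite !ord1 mulg1 => Bi Bj.
by apply: subgroupMl Bj.
Qed.

Lemma has_index_mul A B C m n : subgroup A -> subgroup B -> B `<=` A -> C `<=` B ->
  has_index A B m -> has_index B C n -> has_index A C (m * n).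
Proof.
move=> sA sB BA CB [t [At tc td]] [u [Bu uc ud]].
rewrite -[m]card_ord -[n]card_ord -card_prod.
apply: (@has_index_finType _ (fun ij => t ij.1 * u ij.2)).
- by move=> [i j] /=; apply: subgroupM => //; apply/BA/Bu.
- move=> x /tc[i /uc[j Cj]]; exists (i, j) => /=.
  by rewrite invgM -mulgA.
- move=> [i j] [i' j'] /= h.
  have ii : i = i'.
    apply: td; move: (CB _ h); rewrite invgM !mulgA => /(subgroupMr sB (Bu _)).
    by rewrite -mulgA => /(subgroupMl sB (subgroupV sB (Bu _))).
  by move: h; rewrite -ii invgM -mulgA mulKg => /ud ->.
Qed.

Definition fin_index A B := exists n, has_index A B n.

Lemma fin_index_mid A B C : subgroup B -> C `<=` B -> B `<=` A -> subgroup C ->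
  fin_index A C -> fin_index A B /\ fin_index B C.
Proof.
move=> sB CB BA sC [n [t [At tc td]]].
have [f fP] : {f : G -> option 'I_n & forall x, A x -> exists2 i, f x = Some i & C ((t i)^-1 * x)}.
  exists (fun x => [pick i | `[< C ((t i)^-1 * x) >] ]) => x /tc[i Ci].
  by case: pickP => [j /asboolP Cj|/(_ i)/asboolP//]; exists j.
have fC x y : A x -> A y -> f x = f y -> C (x^-1 * y).
  move=> /fP[i -> Ci] /fP[j -> Cj] [ij]; rewrite -ij in Cj.
  by apply: subgroupVt Cj => //; apply: subgroupVl.
split.
  by have [||k _ ?] := @has_index_label _ f A B; [move=> *; exact/CB/fC | | exists k].
by have [||k _ ?] := @has_index_label _ f B C; [move=> *; apply: fC => //; apply: BA | | exists k].
Qed.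

(* [A : B] = [AY : BY] [A ∩ Y : B ∩ Y] for a normal subgroup Y. *)
Lemma has_index_split A B Y k : subgroup A -> subgroup B -> normal_subgroup Y -> B `<=` A ->
  has_index A B k -> exists m n,
  [/\ has_index (A `&` Y) (B `&` Y) m, has_index (mulset A Y) (mulset B Y) n & k = (n * m)%N].
Proof.
move=> sA sB nY BA Ak; have [sY nY'] := nY.
have [t [At tc td]] := Ak.
have [f fP] : {f : G -> option 'I_k & forall x, A x -> exists2 i, f x = Some i & B ((t i)^-1 * x)}.
  exists (fun x => [pick i | `[< B ((t i)^-1 * x) >] ]) => x /tc[i Ci].
  by case: pickP => [j /asboolP Cj|/(_ i)/asboolP//]; exists j.
have fB x y : A x -> A y -> f x = f y -> B (x^-1 * y).
  move=> /fP[i -> Ci] /fP[j -> Cj] [ij]; rewrite -ij in Cj.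
  by apply: subgroupVt Cj => //; apply: subgroupVl.
have [||m _ Am] := @has_index_label _ f (A `&` Y) (B `&` Y).
- move=> x y [Ax Yx] [Ay Yy] fxy; split; first exact: fB.
  by apply: subgroupM => //; apply: subgroupV.
- exact: subgroupSI.
have sBY := subgroup_mulset sB nY.
(* A coset of BY in AY is labelled by some [t i] that it contains. *)
pose g x := [pick i | `[< mulset B Y ((t i)^-1 * x) >] ].
have gP x : mulset A Y x -> exists2 i, g x = Some i & mulset B Y ((t i)^-1 * x).
  move=> [a /tc[i Bi] [b Yb ->]]; rewrite /g; case: pickP => [j /asboolP|/(_ i)/asboolP].
    by exists j.
  by case; exists ((t i)^-1 * a) => //; exists b => //; rewrite mulgA.
have [||n _ An] := @has_index_label _ g (mulset A Y) (mulset B Y).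
- move=> x y /gP[i -> Ci] /gP[j -> Cj] [ij]; rewrite -ij in Cj.
  by apply: subgroupVt Cj => //; apply: subgroupVl.
- by [].
exists m, n; split => //; apply: (has_index_uniq sB Ak).
(* Representatives of AY modulo BY can be moved into A; their products with representatives of A ∩ Y
   modulo B ∩ Y form a transversal of B in A. *)
case: Am => u [Au uc ud]; case: An => v [Av vc vd].
have /choice[a aP] : forall j, exists a, A a /\ mulset B Y ((v j)^-1 * a).
  move=> j; case: (Av j) => a Aa [b Yb ->]; exists a; split => //.
  rewrite invgM mulgVK; apply: mulsetr => //.
  exact: subgroupV.
have aA j : A (a j) by case: (aP j).
have aB j : mulset B Y ((v j)^-1 * a j) by case: (aP j).
rewrite -[n]card_ord -[m]card_ord -card_prod.
apply: (@has_index_finType _ (fun ij => a ij.1 * u ij.2)).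
- by move=> [i j] /=; apply: subgroupM => //; case: (Au j).
- move=> x Ax; have [|i Bx] := vc x; first exact: mulsetl.
  have [b Bb [y Yy ex]] := subgroupVt sBY (subgroupVl sBY (aB i)) Bx.
  have ey : ((a i)^-1 * x) * b^-1 = y ^ b^-1 by rewrite ex conjgE invgK mulgA.
  have [|j [Bj Yj]] := uc (y ^ b^-1).
    split; last exact: nY'.
    rewrite -ey; apply: subgroupM => //; last by apply: subgroupV => //; apply: BA.
    by apply: subgroupM => //; apply: subgroupV.
  exists (i, j) => /=; rewrite invgM -mulgA.
  have -> : (a i)^-1 * x = y ^ b^-1 * b by rewrite -ey mulgVK.
  by rewrite mulgA; apply: subgroupM.
- move=> [i j] [i' j'] /= h.
  have ii : i = i'.
    apply: vd; apply: subgroupVt (aB i) _ => //.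
    apply: (@subgroupVt _ _ (a i')) => //; last exact: subgroupVl.
    have Y1 l : mulset B Y (u l) by case: (Au l) => _; apply: mulsetr.
    have : mulset B Y ((a i * u j)^-1 * (a i' * u j')) by apply: mulsetl.
    rewrite invgM !mulgA => /(subgroupMr sBY (Y1 _)).
    by rewrite -mulgA => /(subgroupMl sBY (subgroupV sBY (Y1 _))).
  rewrite -ii in h *; move: h; rewrite invgM -mulgA mulKg => h.
  congr pair; apply: ud; split => //.
  by apply: subgroupM => //; [apply: subgroupV => // |]; case: (Au j); case: (Au j').
Qed.

End Subgroups.

(** * Subgroups of bounded index in finitely generated groups *)

Section BoundedIndex.
Variable G : groupType.
Local Open Scope classical_set_scope.
Local Open Scope group_scope.
Implicit Types (A B C H K Y : set G) (x y z : G) (s : seq G).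

Lemma has_index_leq_sub A B C n : subgroup A -> subgroup B -> subgroup C ->
  C `<=` B -> B `<=` A -> has_index A C n -> exists2 m, m <= n & has_index A B m.
Proof.
move=> sA sB sC CB BA AC; have [[m AB] [k BC]] := fin_index_mid sB CB BA sC (ex_intro _ n AC).
exists m => //; rewrite (has_index_uniq sC AC (has_index_mul sA sB BA CB AB BC)).
by rewrite leq_pmulr // (has_index_gt0 sB BC).
Qed.

Lemma fin_index_trans A B C : subgroup A -> subgroup B -> B `<=` A -> C `<=` B ->
  fin_index A B -> fin_index B C -> fin_index A C.
Proof. by move=> sA sB BA CB [m Am] [n Bn]; exists (m * n)%N; apply: has_index_mul Am Bn. Qed.

Lemma fin_index_setI A B C : subgroup A -> subgroup B -> subgroup C ->
  fin_index A B -> fin_index A C -> fin_index A (B `&` C).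
Proof.
move=> sA sB sC [m [t [_ tc _]]] [n [u [_ uc _]]].
have tc' x : exists i, A x -> B ((t i)^-1 * x).
  have [/tc[i Bi]|nA] := pselect (A x); first by exists i.
  by have [i _] := tc _ (subgroup1 sA); exists i.
have uc' x : exists i, A x -> C ((u i)^-1 * x).
  have [/uc[i Bi]|nA] := pselect (A x); first by exists i.
  by have [i _] := uc _ (subgroup1 sA); exists i.
have [f fP] := choice tc'; have [g gP] := choice uc'.
have [||k _ ?] := @has_index_label _ _ (fun x => (f x, g x)) A (B `&` C); last by exists k.
  move=> x y Ax Ay [fxy gxy]; move: (fP x Ax) (fP y Ay) (gP x Ax) (gP y Ay).
  rewrite fxy gxy => fx fy gx gy; split; first by apply: subgroupVt fy => //; apply: subgroupVl.
  by apply: subgroupVt gy => //; apply: subgroupVl.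
exact: subgroupSI.
Qed.

Definition generates s := forall H, subgroup H -> (forall x, x \in s -> H x) -> forall x, H x.

Definition mhom (M : groupType) (f : G -> M) := forall x y, f (x * y) = f x * f y.

Lemma mhom1 (M : groupType) (f : G -> M) : mhom f -> f 1 = 1.
Proof. by move=> fM; apply: (@mulIg _ (f 1)); rewrite -fM !mul1g. Qed.

Lemma mhomV (M : groupType) (f : G -> M) x : mhom f -> f x^-1 = (f x)^-1.
Proof. by move=> fM; apply: (@mulIg _ (f x)); rewrite -fM !mulVg (mhom1 fM). Qed.

Lemma mhomX (M : groupType) (f : G -> M) x n : mhom f -> f (x ^+ n) = f x ^+ n.
Proof. by move=> fM; elim: n => [|n IH]; rewrite ?(mhom1 fM) // !expgS fM IH. Qed.

Lemma mhomJ (M : groupType) (f : G -> M) x y : mhom f -> f (x ^ y) = f x ^ f y.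
Proof. by move=> fM; rewrite !conjgE !fM mhomV. Qed.

Lemma mhomR (M : groupType) (f : G -> M) x y : mhom f -> f [~ x, y] = [~ f x, f y].
Proof. by move=> fM; rewrite !commgEl fM mhomV // mhomJ. Qed.

Lemma mhom_ext (M : groupType) s (f g : G -> M) : generates s -> mhom f -> mhom g ->
  (forall x, x \in s -> f x = g x) -> forall x, f x = g x.
Proof.
move=> gs fM gM; apply: (gs [set x | f x = g x]).
apply: subgroupI => [|x y /= fx fy]; first by rewrite /= !mhom1.
by rewrite fM gM fx !mhomV // fy.
Qed.

(** This replaces a subgroup of index n by a homomorphism to the symmetric group, which is
    determined by its values on generators. *)
Lemma coset_action H n : subgroup H -> has_index [set: G] H n ->
  exists p : G -> 'S_n, mhom p /\ exists i, forall x, H x <-> p x i = i.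
Proof.
move=> sH [t [_ tc td]].
(* Permutations compose from left to right, so x acts on the left cosets as multiplication by its
   inverse. *)
have /choice[f fP] : forall xi : G * 'I_n, exists j, H ((t j)^-1 * (xi.1^-1 * t xi.2)).
  by move=> [x i]; apply: tc.
have f_inj x : injective (fun i => f (x, i)).
  move=> i j ij; move: (fP (x, i)) (fP (x, j)); rewrite ij /= => Hi Hj.
  by apply: td; move: (subgroupVt sH (subgroupVl sH Hi) Hj); rewrite invgM -mulgA mulKg.
have fE x i j : H ((t j)^-1 * (x^-1 * t i)) -> f (x, i) = j.
  move=> Hj; apply: td; apply: (@subgroupVt _ _ _ (x^-1 * t i)) => //.
  by apply: subgroupVl => //; apply: (fP (x, i)).
exists (fun x => perm (f_inj x)); split.
  move=> x y; apply/permP => i; rewrite permM !permE; apply: fE.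
  by have := subgroupM sH (fP (y, f (x, i))) (fP (x, i)); gnorm.
have [i0 /subgroupV Hi0] := tc 1 I; rewrite mulg1 in Hi0.
exists i0 => x; rewrite permE; move: (Hi0 sH); rewrite invgK => Ht.
have Htx : H x <-> H ((t i0)^-1 * (x^-1 * t i0)).
  split => [Hx|].
    apply: subgroupM => //; first exact: subgroupV.
    by apply: subgroupM => //; apply: subgroupV.
  move=> /(subgroupMl sH (subgroupV sH Ht))/(subgroupMr sH Ht)/(subgroupV sH).
  by rewrite invgK.
split => [/Htx/fE//|fx]; apply/Htx.
by have := fP (x, i0); rewrite /= fx.
Qed.

(* The intersection of all subgroups of index at most [N]; phrased with actions
   it is visibly stable under all endomorphisms. *)
Definition bcore N : set G :=
  [set x | forall n (p : G -> 'S_n), n <= N -> mhom p -> p x = 1].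

Lemma bcore_subgroup N : subgroup (bcore N).
Proof.
apply: subgroupI => [n p _ pM|x y Kx Ky n p nN pM]; first exact: mhom1.
by rewrite pM mhomV // (Kx _ _ nN pM) (Ky _ _ nN pM) invg1 mulg1.
Qed.

Lemma bcore_hom N (f : G -> G) x : mhom f -> bcore N x -> bcore N (f x).
Proof. by move=> fM Kx n p nN pM; apply: (Kx n (p \o f)) => // y z /=; rewrite fM pM. Qed.

Lemma bcore_sub N H n : subgroup H -> has_index [set: G] H n -> n <= N -> bcore N `<=` H.
Proof. by move=> sH /(coset_action sH)[p [pM [i pi]]] nN x Kx; apply/pi; rewrite (Kx n) ?perm1. Qed.

Lemma bcore_fin_index s N : generates s -> fin_index [set: G] (bcore N).
Proof.
move=> gs.
pose K n : set G := [set x | forall p : G -> 'S_n, mhom p -> p x = 1].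
have sK n : subgroup (K n).
  apply: subgroupI => [p pM|x y Kx Ky p pM]; first exact: mhom1.
  by rewrite pM mhomV // (Kx p) // (Ky p) // invg1 mulg1.
have fK n : fin_index [set: G] (K n).
  (* [e q] is a homomorphism with the values [q] on the generators, or the trivial map if there is
     none. As there are finitely many [q], the tuple of all [e q x] is a finite label for x. *)
  pose ext (q : {ffun 'I_(size s) -> 'S_n}) (p : G -> 'S_n) :=
    mhom p /\ forall i : 'I_(size s), p (nth 1 s i) = q i.
  have /choice[e eP] : forall q, exists p : G -> 'S_n, (exists p', ext q p') -> ext q p.
    move=> q; have [[p qp]|nq] := pselect (exists p', ext q p'); first by exists p.
    by exists (fun=> 1).
  have [||k _ ?] := @has_index_label G _ (fun x => [ffun q => e q x]) [set: G] (K n).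
  - move=> x y _ _ xy p pM; pose q := [ffun i : 'I_(size s) => p (nth 1 s i)].
    have qp : ext q p by split => // i; rewrite ffunE.
    have [eM eq] := eP q (ex_intro _ p qp).
    have pe z : p z = e q z.
      apply: (mhom_ext gs) => // {}z zs; have iz : index z s < size s by rewrite index_mem.
      have := eq (Ordinal iz); have := qp.2 (Ordinal iz).
      by rewrite /= nth_index // => -> ->.
    by move/ffunP/(_ q): xy; rewrite !ffunE pM mhomV // !pe => ->; rewrite mulVg.
  - exact: sK.
  - by exists k.
elim: N => [|N IH].
  have [k fk] := fK 0; exists k; congr (has_index _ _ _): fk.
  apply/seteqP; split => x Kx => [n p|p pM]; last exact: Kx.
  by rewrite leqn0 => /eqP n0; move: p; rewrite n0 => p; apply: Kx.
have [k fk] := fin_index_setI (subgroupT G) (bcore_subgroup N) (sK N.+1) IH (fK N.+1).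
exists k; congr (has_index _ _ _): fk.
apply/seteqP; split => x; last first.
  move=> Kx; split => [n p nN pM|p pM]; last exact: Kx.
  by apply: Kx => //; apply: leqW.
move=> [Kx K'x] n p; rewrite leq_eqVlt => /orP[/eqP nE|nN]; last exact: Kx.
by move: p; rewrite nE => p; apply: K'x.
Qed.

(* A subgroup of index n is a point stabiliser of an action on n points, which is determined by
   the images of the generators; hence there are only finitely many candidates for J. *)
Lemma chain_stable s (H : nat -> set G) N : generates s ->
  (forall m n, m <= n -> H n `<=` H m) ->
  exists n0, forall J m n, subgroup J -> has_index [set: G] J n -> n <= N ->
    H m `<=` J -> H n0 `<=` J.
Proof.
move=> gs Hd.
suff ex n : exists n0, forall J m, subgroup J -> has_index [set: G] J n ->
    H m `<=` J -> H n0 `<=` J.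
  have [f fP] := choice ex; exists (\max_(n < N.+1) f n) => J m n sJ Jn nN HJ.
  apply: subset_trans (fP _ _ _ sJ Jn HJ); apply: Hd.
  by apply: (@leq_bigmax _ (fun n : 'I_N.+1 => f n) (Ordinal (nN : n < N.+1))).
pose J (q : {ffun 'I_(size s) -> 'S_n} * 'I_n) : set G := [set x | forall p : G -> 'S_n,
  mhom p -> (forall i : 'I_(size s), p (nth 1 s i) = q.1 i) -> p x q.2 = q.2].
have /choice[f fP] : forall q, exists m, (exists m', H m' `<=` J q) -> H m `<=` J q.
  move=> q; have [[m Hm]|nq] := pselect (exists m', H m' `<=` J q); first by exists m.
  by exists 0.
exists (\max_q f q) => K m sK /(coset_action sK)[p [pM [i pi]]] HK.
pose q := [ffun i : 'I_(size s) => p (nth 1 s i)].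
have JE x : J (q, i) x <-> K x.
  split => [/(_ p pM)|Kx r rM rp].
    by move=> /= h; apply/pi; apply: h => j; rewrite ffunE.
  have -> : r x = p x.
    apply: (mhom_ext gs) => // y ys; have iz : index y s < size s by rewrite index_mem.
    by have := rp (Ordinal iz); rewrite /= ffunE /= nth_index.
  exact/pi.
have : H (f (q, i)) `<=` J (q, i) by apply: fP; exists m => x /HK/JE.
move=> h x Hx; apply/JE/h; apply: Hd Hx.
exact: (@leq_bigmax _ f).
Qed.

(** For normal B contained in normal A this is the kernel of the conjugation action on A / B. *)
Definition centr_mod A B : set G := [set x | forall a, A a -> B [~ a, x]].

(** Elements of G inducing the same self-map of the q cosets in A / B agree modulo the centraliser,
    and there are q ^ q self-maps. *)
Lemma centr_mod_index A B q : normal_subgroup A -> normal_subgroup B -> B `<=` A ->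
  has_index A B q ->
  subgroup (centr_mod A B) /\ exists2 n, n <= q ^ q & has_index [set: G] (centr_mod A B) n.
Proof.
move=> [sA nA] [sB nB] BA [t [At tc td]].
have sC : subgroup (centr_mod A B).
  apply: subgroupI => [a Aa|x y Cx Cy a Aa]; first by rewrite commg1; apply: subgroup1.
  have -> : [~ a, x * y^-1] = ([~ a, y]^-1 * [~ a, x]) ^ y^-1 by gnorm.
  by apply: nB; apply: subgroupM => //; [apply: subgroupV => //; apply: Cy | apply: Cx].
split => //.
have /choice[f fP] : forall xi : G * 'I_q, exists j, B ((t j)^-1 * (t xi.2) ^ (xi.1^-1)).
  by move=> [x i]; apply: tc; apply: nA.
have [|m mq ?] :=
  @has_index_label G _ (fun x => [ffun i => f (x, i)]) [set: G] (centr_mod A B) _ sC.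
  move=> x y _ _ xy a /tc[i Bi].
  have Bt : B ((t i)^-1 * (t i) ^ (x^-1 * y)).
    have Bx := fP (x, i); have := fP (y, i); move/ffunP/(_ i): xy; rewrite !ffunE => <- By.
    have /(nB _ y) := subgroupVt sB (subgroupVl sB By) Bx.
    by rewrite conjMg conjVg /= -!conjgM mulVg conjg1.
  have -> : [~ a, x^-1 * y] = [~ (t i)^-1 * a, x^-1 * y] *
      ((t i)^-1 * t i ^ (x^-1 * y)) ^ (((t i)^-1 * a) ^ (x^-1 * y)).
    by gnorm.
  apply: subgroupM => //; last exact: nB.
  by rewrite commgEl; apply: subgroupM => //; [apply: subgroupV | apply: nB].
by exists m => //; rewrite card_ffun card_ord in mq.
Qed.

End BoundedIndex.

(** * Chains with central factors *)

Section CentralChains.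
Variable G : groupType.
Local Open Scope classical_set_scope.
Local Open Scope group_scope.
Implicit Types (A B C D H K X Y Z W : set G) (x y z : G) (s : seq G).

(* [cchain D X Z n]: there is a chain from [X] to [Z] with [n] the product of the indices of some
   of its steps, all of which are central for the action of [D]. *)
Inductive cchain D X : set G -> nat -> Prop :=
| CRefl : cchain D X X 1
| CStep W Z n m of cchain D X W n & subgroup Z & W `<=` Z &
    (forall d z, D d -> Z z -> Z (z ^ d)) & has_index Z W m : cchain D X Z n
| CCentral W Z n m of cchain D X W n & subgroup Z & W `<=` Z &
    D `<=` centr_mod Z W & has_index Z W m : cchain D X Z (n * m)%N.

Lemma cchain_sub D X Z n : subgroup X -> cchain D X Z n ->
  [/\ subgroup Z, X `<=` Z & exists2 N, has_index Z X N & n %| N].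
Proof.
move=> sX.
elim=> {Z n} [|W Z n m _ [sW XW [N WN nN]] sZ WZ _ ZW|W Z n m _ [sW XW [N WN nN]] sZ WZ _ ZW].
- by split => //; exists 1%N => //; apply: has_index1.
- split => //; first exact: subset_trans WZ.
  by exists (m * N)%N; [apply: has_index_mul ZW WN | apply: dvdn_mull].
- split => //; first exact: subset_trans WZ.
  exists (m * N)%N; first exact: has_index_mul ZW WN.
  by rewrite mulnC dvdn_mul.
Qed.

Lemma cchain_cat D X Y Z m n : cchain D X Y m -> cchain D Y Z n -> cchain D X Z (m * n)%N.
Proof.
move=> XY; elim => {Z n} [|W Z n k _ IH sZ WZ nZ ZW|W Z n k _ IH sZ WZ nZ ZW].
- by rewrite muln1.
- exact: CStep IH sZ WZ nZ ZW.
- by rewrite mulnA; apply: CCentral IH sZ WZ nZ ZW.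
Qed.

(** Intersecting the chain with Y gives the lower part and multiplying it by Y the upper part.
    Central steps stay central in both, and [has_index_split] factors each index. *)
Lemma cchain_split D X Y Z n : subgroup X -> normal_subgroup Y -> X `<=` Y -> Y `<=` Z ->
  cchain D X Z n ->
  exists n1 n2, [/\ cchain D X Y n1, cchain D Y Z n2 & n = (n1 * n2)%N].
Proof.
move=> sX nY XY YZ h; have [sY nY'] := nY.
(* The induction along the chain meets subgroups that do not contain Y, hence the form with Z ∩ Y
   and ZY. *)
suff [n1 [n2 [h1 h2 ->]]] : exists n1 n2,
    [/\ cchain D X (Z `&` Y) n1, cchain D Y (mulset Z Y) n2 & n = (n1 * n2)%N].
  have [sZ _ _] := cchain_sub sX h.
  exists n1, n2; split => //.
    by move: h1; congr cchain; apply/seteqP; split => [x []|x Yx] //; split => //; apply: YZ.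
  move: h2; congr cchain; apply/seteqP; split => [_ [a Za [b Yb ->]]|x Zx].
    by apply: subgroupM => //; apply: YZ.
  exact: mulsetl.
elim: h {YZ} => {Z n} [|W Z n m XW [n1 [n2 [h1 h2 ->]]] sZ WZ nZ ZW
                       |W Z n m XW [n1 [n2 [h1 h2 ->]]] sZ WZ nZ ZW].
- exists 1%N, 1%N; split => //.
    suff -> : X `&` Y = X by apply: CRefl.
    by apply/seteqP; split => [x []|x Xx] //; split => //; apply: XY.
  suff -> : mulset X Y = Y by apply: CRefl.
  apply/seteqP; split => [_ [a Xa [b Yb ->]]|x Yx]; last exact: mulsetr.
  by apply: subgroupM => //; apply: XY.
- have [sW _ _] := cchain_sub sX XW.
  have [m1 [m2 [i1 i2 _]]] := has_index_split sZ sW nY WZ ZW.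
  exists n1, n2; split => //.
    apply: CStep h1 _ _ _ i1; first exact: subgroupSI.
      by move=> x [Wx Yx]; split => //; apply: WZ.
    by move=> d x Dd [Zx Yx]; split; [apply: nZ | apply: nY'].
  apply: CStep h2 _ _ _ i2; first exact: subgroup_mulset.
    by move=> _ [a Wa [b Yb ->]]; exists a; [apply: WZ | exists b].
  move=> d _ Dd [a Za [b Yb ->]]; exists (a ^ d); first exact: nZ.
  by exists (b ^ d); [apply: nY' | rewrite conjMg].
- have [sW _ _] := cchain_sub sX XW.
  have [m1 [m2 [i1 i2 ->]]] := has_index_split sZ sW nY WZ ZW.
  exists (n1 * m1)%N, (n2 * m2)%N; split; last by rewrite (mulnC m2) mulnACA.
    apply: CCentral h1 _ _ _ i1; first exact: subgroupSI.
      by move=> x [Wx Yx]; split => //; apply: WZ.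
    move=> d Dd x [Zx Yx]; split; first exact: nZ.
    by rewrite commgEl; apply: subgroupM => //; [apply: subgroupV | apply: nY'].
  have sWY := subgroup_mulset sW nY.
  apply: CCentral h2 _ _ _ i2; first exact: subgroup_mulset.
    by move=> _ [a Wa [b Yb ->]]; exists a; [apply: WZ | exists b].
  move=> d Dd _ [a Za [b Yb ->]].
  have -> : [~ a * b, d] = b^-1 * [~ a, d] * b ^ d by gnorm.
  apply: subgroupM => //; last by apply: mulsetr => //; apply: nY'.
  apply: subgroupM => //; first by apply: mulsetr => //; apply: subgroupV.
  by apply: mulsetl => //; apply: nZ.
Qed.

(* The action of [D] on [Z / X] only depends on [D] modulo elements acting trivially. *)
Lemma cchain_ext D D' H X Z n : subgroup X -> H `<=` centr_mod Z X ->
  (forall d, D' d -> exists2 e, D e & exists2 h, H h & d = e * h) ->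
  cchain D X Z n -> cchain D' X Z n.
Proof.
move=> sX HZ DD h; elim: h HZ => {Z n} [|W Z n m XW IH sZ WZ nZ ZW|W Z n m XW IH sZ WZ nZ ZW] HZ.
- exact: CRefl.
- have [sW XsW _] := cchain_sub sX XW.
  apply: (CStep (IH _) sZ WZ _ ZW); first by move=> h Hh w Ww; apply: HZ => //; apply: WZ.
  move=> _ z /DD[e De [h Hh ->]] Zz; rewrite conjgM.
  have -> : (z ^ e) ^ h = z ^ e * [~ z ^ e, h] by gnorm.
  apply: subgroupM => //; first exact: nZ.
  by apply/WZ/XsW/HZ => //; apply: nZ.
- have [sW XsW _] := cchain_sub sX XW.
  apply: (CCentral (IH _) sZ WZ _ ZW); first by move=> h Hh w Ww; apply: HZ => //; apply: WZ.
  move=> _ /DD[e De [h Hh ->]] z Zz.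
  have Wze : W [~ z, e] by apply: nZ.
  have -> : [~ z, e * h] = [~ z, e] * [~ z ^ e, h] by gnorm.
  apply: subgroupM => //; apply/XsW/HZ => //.
  have -> : z ^ e = z * [~ z, e] by gnorm.
  by apply: subgroupM => //; apply: WZ.
Qed.

(** * Transport along an injective endomorphism *)

Section Image.
Variables (f : G -> G) (fM : mhom f) (fI : injective f).

Lemma image_subgroup H : subgroup H -> subgroup (f @` H).
Proof.
move=> sH; apply: subgroupI; first by exists 1; [apply: subgroup1 | apply: mhom1].
move=> _ _ [x Hx <-] [y Hy <-]; exists (x * y^-1); last by rewrite fM mhomV.
by apply: subgroupM => //; apply: subgroupV.
Qed.

Lemma image_mem A x : (f @` A) (f x) <-> A x.
Proof. by split => [[y Ay /fI <-]|Ax] //; exists x. Qed.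

(** Conjugation by g on the normal image of [f] pulls back to an endomorphism [h] of G, which
    preserves K. *)
Lemma image_normal K : normal_subgroup (f @` [set: G]) -> subgroup K ->
  (forall h : G -> G, mhom h -> forall x, K x -> K (h x)) -> normal_subgroup (f @` K).
Proof.
move=> nf sK Kh; split; first exact: image_subgroup.
move=> _ g [x Kx <-].
have /choice[h hP] : forall y, exists z, f z = f y ^ g.
  by move=> y; have [|z _ fz] := nf.2 (f y) g; [exists y | exists z].
exists (h x); last exact: hP.
by apply: Kh => // y z; apply: fI; rewrite fM !hP fM conjMg.
Qed.

Lemma image_has_index A B n : has_index (f @` A) (f @` B) n <-> has_index A B n.
Proof.
split => -[t [At tc td]].
  have /choice[u uP] : forall i, exists x, A x /\ f x = t i.
    by move=> i; have [x Ax fx] := At i; exists x.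
  exists u; split => [i|x Ax|i j Bij]; first by case: (uP i).
    have [|i Bi] := tc (f x); first by exists x.
    exists i; apply/image_mem; rewrite fM mhomV //.
    by case: (uP i) => _ ->.
  apply: td; rewrite -(uP i).2 -(uP j).2 -mhomV // -fM.
  exact/image_mem.
exists (f \o t); split => [i|_ [x Ax <-]|i j]; first by exists (t i).
  have [i Bi] := tc _ Ax; exists i; rewrite /= -mhomV // -fM; exact/image_mem.
by rewrite /= -mhomV // -fM => /image_mem/td.
Qed.

Lemma image_subset A B : f @` A `<=` f @` B <-> A `<=` B.
Proof.
split => AB x; first by move=> Ax; apply/image_mem/AB/image_mem.
by move=> [y Ay <-]; exists y => //; apply: AB.
Qed.

Lemma image_centr_mod D A B : f @` D `<=` centr_mod (f @` A) (f @` B) <-> D `<=` centr_mod A B.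
Proof.
split => DAB.
  move=> d Dd a Aa; apply/image_mem; rewrite mhomR //; apply: DAB; exact/image_mem.
by move=> _ [d Dd <-] _ [a Aa <-]; rewrite -mhomR //; apply/image_mem/DAB.
Qed.

Lemma cchain_image D X Z n : cchain D X Z n -> cchain (f @` D) (f @` X) (f @` Z) n.
Proof.
elim => {Z n} [|W Z n m _ IH sZ WZ nZ ZW|W Z n m _ IH sZ WZ nZ ZW].
- exact: CRefl.
- apply: (CStep IH (image_subgroup sZ) _ _ (iffRL (image_has_index _ _ _) ZW)).
    exact/image_subset.
  by move=> _ _ [d Dd <-] [z Zz <-]; rewrite -mhomJ //; apply/image_mem/nZ.
- apply: (CCentral IH (image_subgroup sZ) _ _ (iffRL (image_has_index _ _ _) ZW)).
    exact/image_subset.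
  exact/image_centr_mod.
Qed.

(** Each subgroup in the chain lies inside the image of [f], so it is the image of its preimage. *)
Lemma cchain_image_inv D X Z n : subgroup X ->
  cchain (f @` D) (f @` X) (f @` Z) n -> cchain D X Z n.
Proof.
move=> sX; move EZ: (f @` Z) => Z' h.
elim: h Z EZ => {Z' n} [|W' Z' n m XW IH sZ WZ nZ ZW|W' Z' n m XW IH sZ WZ nZ ZW] Z EZ; subst.
- suff -> : Z = X by apply: CRefl.
  by apply/seteqP; split; apply/image_subset; rewrite EZ.
- pose W := [set w | W' (f w)].
  have EW : f @` W = W'.
    apply/seteqP; split => [_ [w Ww <-]//|w Ww].
    by have [z Zz fz] := WZ _ Ww; exists z => //; rewrite /W /= fz.
  rewrite -EW in WZ ZW.
  have sZ' : subgroup Z.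
    apply: subgroupI; first by apply/image_mem; rewrite mhom1 //; apply: subgroup1.
    move=> x y Zx Zy; apply/image_mem; rewrite fM mhomV //.
    by apply: subgroupM => //; apply: subgroupV => //; apply/image_mem.
  apply: (CStep (IH _ EW) sZ' _ _ (iffLR (image_has_index _ _ _) ZW)).
    exact/image_subset.
  by move=> d z Dd Zz; apply/image_mem; rewrite mhomJ //; apply: nZ; apply/image_mem.
- pose W := [set w | W' (f w)].
  have EW : f @` W = W'.
    apply/seteqP; split => [_ [w Ww <-]//|w Ww].
    by have [z Zz fz] := WZ _ Ww; exists z => //; rewrite /W /= fz.
  rewrite -EW in WZ ZW nZ.
  have sZ' : subgroup Z.
    apply: subgroupI; first by apply/image_mem; rewrite mhom1 //; apply: subgroup1.
    move=> x y Zx Zy; apply/image_mem; rewrite fM mhomV //.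
    by apply: subgroupM => //; apply: subgroupV => //; apply/image_mem.
  apply: (CCentral (IH _ EW) sZ' _ _ (iffLR (image_has_index _ _ _) ZW)).
    exact/image_subset.
  exact/image_centr_mod.
Qed.

End Image.

Definition nsec X Z := [/\ normal_subgroup X, normal_subgroup Z, X `<=` Z & fin_index Z X].

Lemma nsec_trans X Y Z : nsec X Y -> nsec Y Z -> nsec X Z.
Proof.
move=> [nX nY XY fXY] [_ nZ YZ fYZ]; split => //; first exact: subset_trans YZ.
by apply: fin_index_trans fYZ fXY => //; [case: nZ | case: nY].
Qed.

(* The largest contribution of central factors of [Z / X] under the action of [D]. *)
Definition tau D X Z : nat :=
  xget 0 [set n | cchain D X Z n /\ forall m, cchain D X Z m -> m <= n].

Lemma tauP D X Z : nsec X Z ->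
  cchain D X Z (tau D X Z) /\ forall m, cchain D X Z m -> m <= tau D X Z.
Proof.
move=> [[sX nX] [sZ nZ] XZ [N ZX]]; rewrite /tau; case: xgetP => [n _ //|h]; exfalso.
have ex : exists n, `[< cchain D X Z n >].
  exists 1%N; apply/asboolP; apply: (CStep (CRefl D X) sZ XZ _ ZX).
  by move=> d z _; apply: nZ.
have ub n : `[< cchain D X Z n >] -> n <= N.
  move/asboolP => /(cchain_sub sX)[_ _ [k Zk nk]].
  rewrite (has_index_uniq sX ZX Zk) dvdn_leq //.
  exact: has_index_gt0 Zk.
case: (ex_maxnP ex ub) => n /asboolP cn nmax; apply: (h n); split => // m cm.
exact/nmax/asboolP.
Qed.

Lemma tau_dvd D X Z N : nsec X Z -> has_index Z X N -> tau D X Z %| N.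
Proof.
move=> s ZX; have [c _] := tauP D s; have [[sX _] _ _ _] := s.
have [_ _ [k Zk]] := cchain_sub sX c.
by rewrite (has_index_uniq sX ZX Zk).
Qed.

Lemma tau_gt0 D X Z : nsec X Z -> 0 < tau D X Z.
Proof.
move=> s; have [_ [sZ _] _ [N ZX]] := s.
exact: dvdn_gt0 (has_index_gt0 sZ ZX) (tau_dvd D s ZX).
Qed.

(** Concatenating optimal chains gives one inequality; splitting an optimal chain at the normal
    subgroup Y gives the other. *)
Lemma tau_mul D X Y Z : nsec X Y -> nsec Y Z -> tau D X Z = (tau D X Y * tau D Y Z)%N.
Proof.
move=> sXY sYZ; have [c1 m1] := tauP D sXY; have [c2 m2] := tauP D sYZ.
have [c m] := tauP D (nsec_trans sXY sYZ).
apply/eqP; rewrite eqn_leq (m _ (cchain_cat c1 c2)) andbT.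
have [[sX _] nY XY _] := sXY; have [_ _ YZ _] := sYZ.
have [n1 [n2 [h1 h2 ->]]] := cchain_split sX nY XY YZ c.
by apply: leq_mul; [apply: m1 | apply: m2].
Qed.

Lemma tau_ext D D' H X Z : nsec X Z -> H `<=` centr_mod Z X ->
  (forall d, D' d -> exists2 e, D e & exists2 h, H h & d = e * h) ->
  tau D X Z <= tau D' X Z.
Proof.
move=> s HZ DD; have [c _] := tauP D s; have [_ m] := tauP D' s.
by apply: m; apply: cchain_ext HZ DD c; case: s => -[].
Qed.

(** A smaller acting set leaves more steps invariant and central. *)
Lemma tau_mono D D' X Z : nsec X Z -> D' `<=` D -> tau D X Z <= tau D' X Z.
Proof.
move=> s DD; have [[sX _] _ _ _] := s.
apply: (@tau_ext _ _ [set 1]) => //.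
  by move=> _ -> a _; rewrite commg1; apply: subgroup1.
by move=> d Dd; exists d; [apply: DD | exists 1 => //; rewrite mulg1].
Qed.

Lemma tau_central D X Z N : nsec X Z -> D `<=` centr_mod Z X -> has_index Z X N ->
  tau D X Z = N.
Proof.
move=> s DZ ZX; have [_ [sZ _] XZ _] := s; have [_ m] := tauP D s.
apply/eqP; rewrite eqn_leq (dvdn_leq (has_index_gt0 sZ ZX) (tau_dvd D s ZX)) /=.
by rewrite -[X in X <= _]mul1n; apply/m/(CCentral (CRefl D X)).
Qed.

Lemma tau_image f D X Z : mhom f -> injective f -> nsec X Z -> nsec (f @` X) (f @` Z) ->
  tau (f @` D) (f @` X) (f @` Z) = tau D X Z.
Proof.
move=> fM fI s s'; have [c m] := tauP D s; have [c' m'] := tauP (f @` D) s'.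
have [[sX _] _ _ _] := s.
apply/eqP; rewrite eqn_leq m' ?m //; last exact: cchain_image.
exact: cchain_image_inv c'.
Qed.

Inductive central_series D X : set G -> Prop :=
| central_series0 : central_series D X X
| central_seriesS W Z of central_series D X W & subgroup W & X `<=` W & D `<=` centr_mod Z W :
    central_series D X Z.

Lemma cchain_full D X Z n N : subgroup X -> cchain D X Z n -> has_index Z X N -> N <= n ->
  central_series D X Z.
Proof.
move=> sX h; elim: h N => {Z n} [|W Z n m XW IH sZ WZ nZ ZW|W Z n m XW IH sZ WZ nZ ZW] N ZX Nn.
- exact: central_series0.
- have [sW XsW [k WX nk]] := cchain_sub sX XW.
  have k0 := has_index_gt0 sW WX.
  have NE : N = (m * k)%N by apply: has_index_uniq ZX _ => //; apply: has_index_mul ZW WX.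
  have m1 : m = 1%N.
    have := has_index_gt0 sZ ZW; have := leq_trans Nn (dvdn_leq k0 nk).
    by rewrite NE -[X in _ <= X]mul1n leq_pmul2r //; case: m {ZW NE} => [|[]].
  rewrite m1 in ZW NE; have -> : Z = W.
    by apply/seteqP; split => //; apply: has_index1_sub ZW.
  by apply: IH WX _; rewrite -[k]mul1n -NE.
- have [sW XsW [k WX nk]] := cchain_sub sX XW.
  have NE : N = (m * k)%N by apply: has_index_uniq ZX _ => //; apply: has_index_mul ZW WX.
  apply: central_seriesS nZ => //; apply: IH WX _.
  by move: Nn; rewrite NE mulnC leq_pmul2r // (has_index_gt0 sZ ZW).
Qed.

Lemma tau_full D X Z N : nsec X Z -> has_index Z X N -> tau D X Z = N -> central_series D X Z.
Proof.
move=> s ZX tN; have [c _] := tauP D s; have [[sX _] _ _ _] := s.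
by apply: cchain_full c ZX _ => //; rewrite tN.
Qed.

End CentralChains.

(** * Self-embeddings with normal image *)

Section SelfEmbedding.
Variable G : groupType.
Local Open Scope classical_set_scope.
Local Open Scope group_scope.
Implicit Types (A B C D H K M : set G) (x y z : G).
Variables (s : seq G) (f : G -> G) (q : nat).
Hypotheses (gs : generates s) (fM : mhom f) (fI : injective f).
Let L := f @` [set: G].
Hypotheses (nL : normal_subgroup L) (Lq : has_index [set: G] L q).

Let nT : normal_subgroup [set: G].
Proof. by split; first exact: subgroupT. Qed.

Let q_gt0 : 0 < q.
Proof. exact: has_index_gt0 (subgroupT G) Lq. Qed.

(** Stability under all endomorphisms, not only automorphisms, gives f(M) ⊆ M and makes both M and
    f(M) normal. *)
Let good M := [/\ subgroup M, fin_index [set: G] M &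
  forall h : G -> G, mhom h -> forall x, M x -> M (h x)].

Let good_bcore N : good (bcore N).
Proof.
split; first exact: bcore_subgroup.
  exact: bcore_fin_index gs.
by move=> h hM x; apply: bcore_hom.
Qed.

Let good_normal M : good M -> normal_subgroup M.
Proof.
move=> [sM _ Mh]; split => // x g; apply: (Mh (fun x => x ^ g)).
by move=> y z; rewrite conjMg.
Qed.

Let good_image_sub M : good M -> f @` M `<=` M.
Proof. by move=> [_ _ Mh] _ [x Mx <-]; apply: Mh. Qed.

Let good_image_normal M : good M -> normal_subgroup (f @` M).
Proof.
by move=> [sM _ Mh]; apply: image_normal.
Qed.

(** As [f] maps G / M onto L / f(M), the index of f(M) in G is q [G : M]; it is also [G : M]
    [M : f(M)]. *)
Let good_index M : good M -> has_index M (f @` M) q.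
Proof.
move=> gM; have [sM [c Gc] _] := gM; have nM := good_normal gM.
have Lc : has_index L (f @` M) c by apply/image_has_index.
have LM : f @` M `<=` L by apply/image_subset.
have Gqc := has_index_mul (subgroupT G) nL.1 (@subsetT _ L) LM Lq Lc.
have [fMs _] := good_image_normal gM.
have [_ [k Mk]] := fin_index_mid sM (good_image_sub gM) (@subsetT _ M) fMs (ex_intro _ _ Gqc).
suff -> : q = k by [].
have Gck := has_index_mul (subgroupT G) sM (@subsetT _ M) (good_image_sub gM) Gc Mk.
have := has_index_uniq fMs Gqc Gck; rewrite mulnC => /eqP.
by rewrite eqn_pmul2l ?(has_index_gt0 (subgroupT G) Gc) // => /eqP.
Qed.

Let nsec1 M : good M -> nsec M [set: G].
Proof. by move=> gM; have [_ ? _] := gM; split => //; apply: good_normal. Qed.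

Let nsec2 M : good M -> nsec (f @` M) M.
Proof.
move=> gM; split; [exact: good_image_normal | exact: good_normal | exact: good_image_sub |].
by exists q; apply: good_index.
Qed.

Let nsec3 : nsec L [set: G].
Proof. by split => //; exists q. Qed.

Let nsec4 M : good M -> nsec (f @` M) L.
Proof.
move=> gM; have [_ [c Gc] _] := gM; split => //; first exact: good_image_normal.
  exact/image_subset.
by exists c; apply/image_has_index.
Qed.

Let Lk k := iter k (fun A => f @` A) [set: G].

Let Lk_dec m n : m <= n -> Lk n `<=` Lk m.
Proof.
have H k : Lk k.+1 `<=` Lk k.
  elim: k => [|k IH] //=; exact/image_subset.
move=> /subnK <-; elim: (n - m) => [|k IH] //.
exact: subset_trans (H _) IH.
Qed.

Let a k M := tau (Lk k) M [set: G].
Let b k M := tau (Lk k) (f @` M) M.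

(** Both sides are [tau] of G / f(M) under [Lk k.+1]. Through L, the section L / f(M) is the image
    of G / M and gives [a k M], while G / L gives q because L acts trivially on it. Through M one
    gets the right side. *)
Let a_b k M : good M -> (q * a k M = a k.+1 M * b k.+1 M)%N.
Proof.
move=> gM; have nsec5 := nsec_trans (nsec2 gM) (nsec1 gM).
have E1 := tau_mul (Lk k.+1) (nsec2 gM) (nsec1 gM).
have E2 := tau_mul (Lk k.+1) (nsec4 gM) nsec3.
rewrite /b mulnC [RHS]mulnC -E1 E2; congr (_ * _)%N.
  by rewrite /a -(tau_image _ fM fI (nsec1 gM) (nsec4 gM)).
rewrite (@tau_central _ _ _ _ q nsec3) //.
move=> d Ld x _; have [sL n] := nL; have Ld' : L d by apply: (Lk_dec (isT : 1 <= k.+1)).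
have -> : [~ x, d] = (d^-1) ^ x * d by gnorm.
by apply: subgroupM => //; apply: n; apply: subgroupV.
Qed.

Let b_dvd k M : good M -> b k M %| q.
Proof. by move=> gM; apply: tau_dvd (nsec2 gM) (good_index gM). Qed.

Let a_mono k M : good M -> a k M <= a k.+1 M.
Proof. by move=> gM; apply: tau_mono (nsec1 gM) _; apply: Lk_dec. Qed.

(** By [a_b], the number [a k M] grows strictly as long as [b k.+1 M] differs from q, but it is
    bounded by [G : M]. *)
Let b_eventually M : good M -> exists k, b k.+1 M = q.
Proof.
move=> gM; have [_ [c Gc] _] := gM; apply: contrapT => nb.
have ak k : k < a k M.
  elim: k => [|k IH]; first exact: tau_gt0 (nsec1 gM).
  apply: leq_ltn_trans IH _; rewrite ltn_neqAle a_mono // andbT.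
  apply/eqP => ak; apply: nb; exists k; apply/eqP; rewrite eq_sym.
  have := a_b k gM; rewrite ak mulnC => /eqP.
  by rewrite eqn_pmul2l // -ak; apply: tau_gt0 (nsec1 gM).
have := dvdn_leq (has_index_gt0 (subgroupT G) Gc) (tau_dvd (Lk c) (nsec1 gM) Gc).
by rewrite leqNgt ak.
Qed.

(* [K] acts trivially on all the sections [M / f M]. *)
Let K : set G := bcore (q ^ q).

Let K_centr M : good M -> K `<=` centr_mod M (f @` M).
Proof.
move=> gM; have [sC [n nq Gn]] := centr_mod_index (good_normal gM) (good_image_normal gM)
  (good_image_sub gM) (good_index gM).
exact: bcore_sub Gn nq.
Qed.

(** The decreasing subgroups [Lk k] meet fewer and fewer of the finitely many cosets of [K]; [k0]
    lies beyond the point where each coset that is ever missed has been missed. *)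
Let Lk_stable : exists k0, forall x, Lk k0 x -> forall k,
  exists2 e, Lk k e & exists2 h, K h & x = e * h.
Proof.
have [sK [n [t [_ tc _]]] _] := good_bcore (q ^ q).
have /choice[g gP] : forall i, exists k, (exists k', ~ exists2 e, Lk k' e & K ((t i)^-1 * e)) ->
    ~ exists2 e, Lk k e & K ((t i)^-1 * e).
  move=> i; have [[k ik]|ni] := pselect (exists k', ~ exists2 e, Lk k' e & K ((t i)^-1 * e)).
    by exists k.
  by exists 0%N.
exists (\max_i g i) => x Lx k; have [i Ki] := tc x I.
have [[e Le Ke]|ne] := pselect (exists2 e, Lk k e & K ((t i)^-1 * e)).
  exists e => //; exists (e^-1 * x); last by rewrite mulVKg.
  exact: (subgroupVt sK (subgroupVl sK Ke) Ki).
exfalso; apply: (gP i); first by exists k.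
by exists x => //; apply: Lk_dec Lx; apply: (@leq_bigmax _ g).
Qed.

(** The value [k0] is uniform in M: since [K] acts trivially on M / f(M), the action of [Lk k0]
    there is already that of every later [Lk k]. *)
Let b_full : exists k0, forall M, good M -> b k0 M = q.
Proof.
have [k0 k0P] := Lk_stable; exists k0 => M gM.
have [k bk] := b_eventually gM.
apply/eqP; rewrite eqn_leq dvdn_leq ?b_dvd //= -[X in X <= _]bk.
by apply: tau_ext (nsec2 gM) (K_centr gM) _ => x /k0P.
Qed.

Let a_bound k M : good M -> a k M <= q ^ k * a 0 M.
Proof.
move=> gM; elim: k => [|k IH]; first by rewrite mul1n.
rewrite expnS -mulnA; apply: leq_trans (leq_mul (leqnn q) IH).
by rewrite a_b // leq_pmulr // tau_gt0 //; apply: nsec2.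
Qed.

Let good_deep M : good M -> exists2 M', good M' & M' `<=` f @` M.
Proof.
move=> gM; have [n Gn] : fin_index [set: G] (f @` M).
  by have [] := nsec_trans (nsec4 gM) nsec3.
by exists (bcore n) => //; apply: bcore_sub Gn _ => //; apply: (good_image_normal gM).1.
Qed.

(* Otherwise [a k0] would at least double whenever [M] is replaced by a good subgroup of [f M],
   while the ratio [a k0 M / a 0 M] is bounded by [q ^ k0]. *)
Let b_zero : exists M, [/\ good M, M `<=` L & b 0 M = q].
Proof.
have [k0 bk0] := b_full; apply: contrapT => nb.
have ex i : exists M, [/\ good M, M `<=` L & 2 ^ i * a 0 M <= a k0 M].
  elim: i => [|i [M [gM ML IH]]].
    exists (bcore q); split => //; first exact: (bcore_sub nL.1 Lq).
    by rewrite mul1n; apply: tau_mono (nsec1 (good_bcore q)) _; apply: Lk_dec.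
  have [M' gM' M'M] := good_deep gM.
  have nM' : nsec M' (f @` M).
    split => //; [exact: good_normal | exact: good_image_normal |].
    have [_ fM' _] := gM'; have [sM' _ _] := gM'; have [sfM _] := good_image_normal gM.
    by case: (fin_index_mid sfM M'M (@subsetT _ _) sM' fM').
  exists M'; split => //.
    by apply: subset_trans ML; apply: subset_trans M'M _; apply: good_image_sub.
  have aE k : a k M' = (tau (Lk k) M' (f @` M) * (b k M * a k M))%N.
    rewrite /a /b -(tau_mul _ (nsec2 gM) (nsec1 gM)) -tau_mul //.
    exact: nsec_trans (nsec2 gM) (nsec1 gM).
  rewrite !aE bk0 // expnS mulnCA; apply: leq_mul.
    by apply: tau_mono nM' _; apply: Lk_dec.
  (* A proper divisor of q is at most q / 2. *)
  have b2 : 2 * b 0 M <= q.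
    have /dvdnP[c qE] := b_dvd 0 gM; rewrite qE leq_mul2r.
    case: c qE => [|[|c]] qE; rewrite ?orbT //.
      by move: q_gt0; rewrite qE.
    by case: nb; exists M; split => //; rewrite [RHS]qE mul1n.
  have -> : (2 * 2 ^ i * (b 0 M * a 0 M))%N = (2 * b 0 M * (2 ^ i * a 0 M))%N.
    by rewrite mulnACA.
  exact: leq_mul.
have [M [gM _ h]] := ex (q ^ k0)%N.
have := leq_trans h (a_bound k0 gM); rewrite leq_pmul2r ?tau_gt0 //; last exact: nsec1.
by rewrite leqNgt ltn_expl.
Qed.

(** For M from [b_zero], [a_b] gives [a 1 M] = [a 0 M]. Split both at L: the factor from L / M does
    not decrease when the action shrinks from G to L, and for L the factor from G / L is q. So that
    factor is at least q for G too, which is the maximum. *)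
Theorem central_series_self_embedding : central_series [set: G] L [set: G].
Proof.
have [M [gM ML b0]] := b_zero.
have nML : nsec M L.
  split => //; first exact: good_normal.
  have [sM fM' _] := gM; exact: (fin_index_mid nL.1 ML (@subsetT _ _) sM fM').2.
have b1 : b 1 M = q.
  apply/eqP; rewrite eqn_leq dvdn_leq ?b_dvd //= -[X in X <= _]b0.
  by apply: tau_mono (nsec2 gM) _; apply: Lk_dec.
have a1 : a 1 M = a 0 M.
  by apply/eqP; have /eqP := a_b 0 gM; rewrite b1 mulnC eqn_pmul2r // eq_sym.
apply: tau_full nsec3 Lq _.
apply/eqP; rewrite eqn_leq dvdn_leq ?(tau_dvd _ nsec3 Lq) //=.
have := a1; rewrite /a (tau_mul _ nML nsec3) (tau_mul [set: G] nML nsec3).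
rewrite [tau (Lk 1) L _](@tau_central _ _ _ _ q nsec3) //; last first.
  move=> d Ld x _; have [sL n] := nL.
  have -> : [~ x, d] = (d^-1) ^ x * d by gnorm.
  by apply: subgroupM => //; apply: n; apply: subgroupV.
move=> E; rewrite -(leq_pmul2l (tau_gt0 (Lk 1) nML)) E leq_mul2r.
by apply/orP; right; apply: tau_mono nML _.
Qed.

End SelfEmbedding.

(** * Finitely generated abelian groups *)

Section FinitelyGeneratedAbelian.
Variable V : zmodType.
Local Open Scope classical_set_scope.
Local Open Scope ring_scope.
Import GRing.Theory.
Implicit Types (E : set V) (l : seq V).

Definition zclosed E := E 0 /\ forall x y, E x -> E y -> E (x - y).

Lemma zclosedN E x : zclosed E -> E x -> E (- x).
Proof. by move=> [E0 ED] Ex; rewrite -[- x]add0r; apply: ED. Qed.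

Lemma zclosedD E x y : zclosed E -> E x -> E y -> E (x + y).
Proof. by move=> zE Ex Ey; rewrite -[y]opprK; apply: (proj2 zE) => //; apply: zclosedN. Qed.

Lemma zclosedMn E x n : zclosed E -> E x -> E (x *+ n).
Proof.
move=> zE Ex; elim: n => [|n IH]; first by rewrite mulr0n; case: zE.
by rewrite mulrS; apply: zclosedD.
Qed.

Lemma zclosedMz E x c : zclosed E -> E x -> E (x *~ c).
Proof.
move=> zE Ex; case: c => n; first exact: zclosedMn.
by rewrite NegzE mulrNz; apply: zclosedN => //; apply: zclosedMn.
Qed.

Definition adjoin E a : set V := [set x | exists c : int, E (x - a *~ c)].

Lemma adjoin_zclosed E a : zclosed E -> zclosed (adjoin E a).
Proof.
move=> zE; split; first by exists 0; rewrite mulr0z subr0; case: zE.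
move=> x y [c Ec] [d Ed]; exists (c - d).
have -> : x - y - a *~ (c - d) = (x - a *~ c) - (y - a *~ d).
  by rewrite mulrzBr !opprB addrACA [RHS]addrACA [- y - _]addrC.
by apply: (proj2 zE).
Qed.

Lemma adjoin_sub E a : E `<=` adjoin E a.
Proof. by move=> x Ex; exists 0; rewrite mulr0z subr0. Qed.

(** Generators are absorbed into the base one at a time, so inductions on [l] run with [E]
    generalised. *)
Fixpoint zspan E l : set V := if l is a :: l' then zspan (adjoin E a) l' else E.

Lemma zspan_zclosed E l : zclosed E -> zclosed (zspan E l).
Proof. by elim: l E => //= a l IH E zE; apply/IH/adjoin_zclosed. Qed.

Lemma zspan_mono E E' l : E `<=` E' -> zspan E l `<=` zspan E' l.
Proof.
elim: l E E' => //= a l IH E E' EE; apply: IH => x [c Ec].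
by exists c; apply: EE.
Qed.

Lemma zspan_sub E l : E `<=` zspan E l.
Proof.
elim: l E => [|a l IH] E; first exact: subset_refl.
exact: subset_trans (adjoin_sub _) (IH _).
Qed.

Lemma zspan_mem E l a : zclosed E -> a \in l -> zspan E l a.
Proof.
elim: l E => //= b l IH E zE; rewrite in_cons => /orP[/eqP->|al].
  by apply: zspan_sub; exists 1; rewrite mulr1z subrr; case: zE.
by apply: IH => //; apply: adjoin_zclosed.
Qed.

(** Finiteness of the torsion modulo E: by induction it has finitely many classes modulo E + Za, and
    two torsion elements in one such class differ, modulo E, by a torsion multiple of a. *)
Lemma zspan_torsion_finite E l : zclosed E -> exists reps : seq V, forall v,
  zspan E l v -> (exists2 k, (0 < k)%N & E (v *+ k)) -> exists2 w, w \in reps & E (v - w).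
Proof.
elim: l E => [|a l IH] E zE /=.
  by exists [:: 0] => v Ev _; exists 0; rewrite ?inE // subr0.
have [reps1 reps1P] := IH _ (adjoin_zclosed a zE).
pose tors v := exists2 k, (0 < k)%N & E (v *+ k).
have torsB u v : tors u -> tors v -> tors (u - v).
  move=> [m m0 Em] [n n0 En]; exists (m * n)%N; first by rewrite muln_gt0 m0.
  rewrite mulrnBl; apply: (proj2 zE); first by rewrite mulrnA; apply: zclosedMn.
  by rewrite mulnC mulrnA; apply: zclosedMn.
(* If a has finite order modulo E, reduce c modulo a positive annihilator [d]; otherwise only c = 0
   gives a torsion multiple, and [d] = 1 will do. *)
have [d d0 dP] : exists2 d, (0 < d)%N & forall c : int, tors (a *~ c) ->
    exists2 i, (i < d)%N & E (a *~ c - a *+ i).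
  have [[d d0 Ed]|na] := pselect (tors a).
    exists d => // c _; exists `|(c %% d)%Z|%N.
      by rewrite -ltz_nat gez0_abs ?modz_ge0 ?ltz_pmod //; case: d d0 {Ed}.
    rewrite pmulrn gez0_abs ?modz_ge0 //; last by case: d d0 {Ed}.
    rewrite -mulrzBr {1}(divz_eq c d) addrK mulrC mulrzA; exact: zclosedMz.
  exists 1%N => // c tc; exists 0%N => //; rewrite mulr0n subr0.
  suff -> : c = 0 by rewrite mulr0z; case: zE.
  apply: contrapT => /eqP c0; apply: na; case: tc => k k0 Ek.
  exists (`|c| * k)%N; first by rewrite muln_gt0 absz_gt0 c0.
  case: c {c0} Ek => n Ek; first by rewrite mulrnA.
  rewrite mulrnA /=; rewrite NegzE mulrNz mulNrn in Ek.
  by rewrite -[X in E X]opprK; apply: zclosedN.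
have /choice[g gP] : forall w, exists v, (exists2 u, tors u & adjoin E a (u - w)) ->
    tors v /\ adjoin E a (v - w).
  move=> w; have [[u tu Eu]|nu] := pselect (exists2 u, tors u & adjoin E a (u - w)).
    by exists u.
  by exists 0.
exists [seq g w + a *+ i | w <- reps1, i <- iota 0 d] => v lv tv.
have [|w wr Ew] := reps1P _ lv.
  by case: tv => k k0 Ek; exists k => //; apply: adjoin_sub.
have [tg Eg] := gP w (ex_intro2 _ _ v tv Ew).
have [c Ec] : adjoin E a (v - g w).
  have -> : v - g w = (v - w) - (g w - w) by rewrite opprB addrA subrK.
  by apply: (proj2 (adjoin_zclosed a zE)).
have [|i id Ei] := dP c.
  have -> : a *~ c = (v - g w) - (v - g w - a *~ c) by rewrite opprB addrC subrK.
  by apply: (torsB (v - g w)); [exact: torsB | exists 1%N].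
exists (g w + a *+ i); first by apply/allpairsP; exists (w, i); rewrite mem_iota.
have -> : v - (g w + a *+ i) = (v - g w - a *~ c) + (a *~ c - a *+ i).
  by rewrite addrA subrK opprD addrA.
exact: zclosedD.
Qed.

(** Two consecutive blocks satisfy relations modulo E + Za, with remainders ka and ha; h times the
    first minus k times the second cancels a. The last coefficient stays nonzero unless k = 0, when
    the first block suffices. *)
Lemma zspan_relation E l (w : nat -> V) : zclosed E -> (forall i, zspan E l (w i)) ->
  exists n, exists2 c : nat -> int, c n != 0 & E (\sum_(i < n.+1) w i *~ c i).
Proof.
elim: l E w => [|a l IH] E w zE lw /=.
  exists 0%N, (fun=> 1) => //; rewrite big_ord1 mulr1z; exact: lw.
have [n [c c0 [k Ek]]] := IH _ _ (adjoin_zclosed a zE) lw.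
have [k0|k0] := eqVneq k 0.
  by exists n, c => //; rewrite k0 mulr0z subr0 in Ek.
have [m [d d0 [h Eh]]] := IH _ (fun i => w (n.+1 + i)%N) (adjoin_zclosed a zE) (fun i => lw _).
exists (n.+1 + m)%N, (fun i => if (i < n.+1)%N then c i * h else - (d (i - n.+1)%N * k)).
  by rewrite ltnNge leq_addr /= addKn oppr_eq0 mulf_neq0.
rewrite -addnS big_split_ord /=.
have -> : \sum_(i < n.+1) w i *~ (if (i < n.+1)%N then c i * h else - (d (i - n.+1)%N * k)) =
    (\sum_(i < n.+1) w i *~ c i) *~ h.
  by rewrite mulrz_suml; apply: eq_bigr => i _; rewrite ltn_ord mulrzA.
have -> : \sum_(i < m.+1) w (n.+1 + i)%N *~ (if (n.+1 + i < n.+1)%N then c (n.+1 + i)%N * h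
    else - (d (n.+1 + i - n.+1)%N * k)) = - (\sum_(i < m.+1) w (n.+1 + i)%N *~ d i) *~ k.
  rewrite -sumrN mulrz_suml; apply: eq_bigr => i _; rewrite ltnNge leq_addr /= addKn mulrNz mulrzA.
  by rewrite mulNrz.
have := proj2 zE _ _ (zclosedMz h zE Ek) (zclosedMz k zE Eh).
rewrite !mulrzBl -!mulrzA [h * k]mulrC opprB addrA subrK mulNrz //.
Qed.

End FinitelyGeneratedAbelian.

(** * Abelian sections as additive groups *)

Record absec (G : groupType) := Absec {
  sec_num : set G;
  sec_den : set G;
  sec_num_subgroup : subgroup sec_num;
  sec_den_subgroup : subgroup sec_den;
  sec_comm : forall x y, sec_num x -> sec_num y -> sec_den [~ x, y]%g
}.

Section AbelianSection.
Variables (G : groupType) (S : absec G).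
Local Open Scope classical_set_scope.
Local Open Scope group_scope.
Let A := sec_num S.
Let B := sec_den S.
Let sA : subgroup A := sec_num_subgroup S.
Let sB : subgroup B := sec_den_subgroup S.
Let cAB x y : A x -> A y -> B [~ x, y] := @sec_comm _ S x y.

Definition sec_pred (C : set G) : bool := `[< exists2 x, A x & C = left_coset B x >].
Definition sec_quot := {C : set G | sec_pred C}.
HB.instance Definition _ := Choice.on sec_quot.

(** Elements outside [A] are replaced by 1, which makes [sec_class] a total function. *)
Let coset_pred x : sec_pred (left_coset B (if `[< A x >] then x else 1)).
Proof.
apply/asboolP; case: asboolP => Ax; first by exists x.
by exists 1 => //; apply: subgroup1.
Qed.

Definition sec_class x : sec_quot := exist (fun C => is_true (sec_pred C)) _ (coset_pred x).

Let rep_ex (C : sec_quot) : {x | A x & sval C = left_coset B x}.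
Proof. by apply: cid2; case: C => C /= /asboolP. Qed.

Definition sec_rep C := s2val (rep_ex C).

Lemma sec_repP C : A (sec_rep C).
Proof. exact: s2valP. Qed.

Lemma sec_class_eq x y : A x -> A y -> sec_class x = sec_class y <-> B (x^-1 * y).
Proof.
move=> Ax Ay; rewrite -left_coset_eq //; split.
  by move=> /(congr1 sval) /=; do 2![case: asboolP => // _].
move=> E; apply/val_inj => /=; do 2![case: asboolP => // _].
Qed.

Lemma sec_repK C : sec_class (sec_rep C) = C.
Proof.
apply/val_inj => /=; case: asboolP => [_|/(_ (sec_repP C))//].
by rewrite /sec_rep; case: (rep_ex C) => x Ax /= <-.
Qed.

Let addq C D := sec_class (sec_rep C * sec_rep D).
Let oppq C := sec_class (sec_rep C)^-1.
Let zeroq := sec_class 1.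

Let repB x : A x -> B (x^-1 * sec_rep (sec_class x)).
Proof. by move=> Ax; apply/sec_class_eq; rewrite ?sec_repK //; apply: sec_repP. Qed.

Let conjB x b : A x -> A b -> B b -> B (b ^ x).
Proof.
move=> Ax Ab Bb; have -> : b ^ x = b * [~ b, x] by gnorm.
by apply: subgroupM => //; apply: cAB.
Qed.

Let addq_class x y : A x -> A y -> addq (sec_class x) (sec_class y) = sec_class (x * y).
Proof.
move=> Ax Ay; symmetry; apply/sec_class_eq.
- exact: subgroupM.
- by apply: subgroupM => //; apply: sec_repP.
set u := sec_rep _; set v := sec_rep _.
have Au : A u by apply: sec_repP.
have Av : A v by apply: sec_repP.
have -> : (x * y)^-1 * (u * v) = (x^-1 * u) ^ y * (y^-1 * v) by gnorm.
apply: subgroupM => //; last exact: repB.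
apply: conjB => //; last exact: repB.
by apply: subgroupM => //; apply: subgroupV.
Qed.

Let classP C : exists2 x, A x & C = sec_class x.
Proof. by exists (sec_rep C); [apply: sec_repP | rewrite sec_repK]. Qed.

Let addqA : associative addq.
Proof.
move=> C D E; have [x Ax ->] := classP C; have [y Ay ->] := classP D.
have [z Az ->] := classP E; rewrite !addq_class ?mulgA //; exact: subgroupM.
Qed.

Let addqC : commutative addq.
Proof.
move=> C D; have [x Ax ->] := classP C; have [y Ay ->] := classP D.
rewrite !addq_class //; apply/sec_class_eq; [exact: subgroupM | exact: subgroupM |].
have -> : (x * y)^-1 * (y * x) = [~ y, x] by gnorm.
exact: cAB.
Qed.

Let A1 : A 1. Proof. exact: subgroup1. Qed.

Let add0q : left_id zeroq addq.
Proof. by move=> C; have [x Ax ->] := classP C; rewrite addq_class // mul1g. Qed.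

Let addNq : left_inverse zeroq oppq addq.
Proof.
move=> C; rewrite -{2}(sec_repK C) addq_class; last exact: sec_repP.
  by rewrite mulVg.
by apply: subgroupV => //; apply: sec_repP.
Qed.

HB.instance Definition _ := GRing.isZmodule.Build sec_quot addqA addqC add0q addNq.

Lemma sec_class1 : sec_class 1 = 0%R.
Proof. by []. Qed.

Lemma sec_classM x y : A x -> A y -> sec_class (x * y) = (sec_class x + sec_class y)%R.
Proof. by move=> Ax Ay; rewrite -addq_class. Qed.

Lemma sec_classX x n : A x -> sec_class (x ^+ n) = (sec_class x *+ n)%R.
Proof.
move=> Ax; elim: n => [|n IH] //.
by rewrite expgS sec_classM ?IH ?GRing.mulrS //; apply: subgroupX.
Qed.

Lemma sec_class_eq0 x : A x -> sec_class x = 0%R <-> B x.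
Proof.
move=> Ax; rewrite -sec_class1 sec_class_eq // mulg1.
by split => [/(subgroupV sB)|/(subgroupV sB)//]; rewrite invgK.
Qed.

Lemma sec_class_surj C : exists2 x, A x & C = sec_class x.
Proof. exact: classP. Qed.

End AbelianSection.

(** * The lower central series *)

Section LowerCentral.
Variable G : groupType.
Local Open Scope classical_set_scope.
Local Open Scope group_scope.
Implicit Types (A B H : set G) (x y z : G).

Lemma smallest_subgroup (S : set G) : subgroup (smallest (@subgroup G) S).
Proof.
apply: subgroupI => [H [sH _]|x y Hx Hy H SH]; first exact: subgroup1.
have [sH _] := SH; apply: subgroupM (Hx _ SH) _ => //; apply: subgroupV (Hy _ SH) => //.
Qed.

Definition der : set G := smallest (@subgroup G) [set [~ x.1, x.2] | x in [set: G * G]].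

Definition gam3 : set G := smallest (@subgroup G) [set [~ x.1, x.2] | x in der `*` [set: G]].

Lemma der_subgroup : subgroup der. Proof. exact: smallest_subgroup. Qed.
Lemma gam3_subgroup : subgroup gam3. Proof. exact: smallest_subgroup. Qed.

Lemma der_comm x y : der [~ x, y].
Proof. by move=> H [_]; apply; exists (x, y). Qed.

Lemma gam3_comm u y : der u -> gam3 [~ u, y].
Proof. by move=> du H [_]; apply; exists (u, y). Qed.

Lemma der_sub H : subgroup H -> (forall x y, H [~ x, y]) -> der `<=` H.
Proof. by move=> sH h; apply: smallest_sub => // _ [[x y] _ <-]; apply: h. Qed.

Lemma gam3_sub H : subgroup H -> (forall u y, der u -> H [~ u, y]) -> gam3 `<=` H.
Proof. by move=> sH h; apply: smallest_sub => // _ [[u y] [/= du _] <-]; apply: h. Qed.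

Lemma preim_subgroup (f : G -> G) H : mhom f -> subgroup H -> subgroup [set x | H (f x)].
Proof.
move=> fM sH; apply: subgroupI => [|x y Hx Hy] /=; first by rewrite mhom1 //; apply: subgroup1.
by rewrite fM mhomV //; apply: subgroupM => //; apply: subgroupV.
Qed.

Lemma der_hom (f : G -> G) x : mhom f -> der x -> der (f x).
Proof.
move=> fM; apply: (der_sub (H := [set x | der (f x)])).
  exact: preim_subgroup der_subgroup.
by move=> y z /=; rewrite mhomR //; apply: der_comm.
Qed.

Lemma der_normal : normal_subgroup der.
Proof.
split; first exact: der_subgroup.
by move=> x g; apply: (der_hom (f := fun y => y ^ g)) => y z; rewrite conjMg.
Qed.

Lemma gam3_hom (f : G -> G) x : mhom f -> gam3 x -> gam3 (f x).
Proof.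
move=> fM; apply: (gam3_sub (H := [set x | gam3 (f x)])).
  exact: preim_subgroup gam3_subgroup.
by move=> u z du /=; rewrite mhomR //; apply: gam3_comm; apply: der_hom.
Qed.

(** The first two lower central factors, G / G' and G' / [G', G]. *)
Definition absec1 := @Absec G [set: G] der (subgroupT G) der_subgroup (fun x y _ _ => der_comm x y).
Definition absec2 := @Absec G der gam3 der_subgroup gam3_subgroup
  (fun x y dx _ => gam3_comm y dx).

Definition cl1 : G -> sec_quot absec1 := sec_class absec1.
Definition cl2 : G -> sec_quot absec2 := sec_class absec2.

Lemma cl1M x y : cl1 (x * y) = (cl1 x + cl1 y)%R. Proof. exact: sec_classM. Qed.
Lemma cl1X x n : cl1 (x ^+ n) = (cl1 x *+ n)%R. Proof. exact: sec_classX. Qed.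
Lemma cl1_eq0 x : cl1 x = 0%R <-> der x. Proof. exact: (sec_class_eq0 (S := absec1)). Qed.
Lemma cl1_eq x y : cl1 x = cl1 y <-> der (x^-1 * y).
Proof. exact: (sec_class_eq (S := absec1)). Qed.
Lemma cl1_surj v : exists x, v = cl1 x.
Proof. by have [x _ ->] := sec_class_surj v; exists x. Qed.
Lemma cl2M x y : der x -> der y -> cl2 (x * y) = (cl2 x + cl2 y)%R.
Proof. exact: (sec_classM (S := absec2)). Qed.
Lemma cl2_eq0 x : der x -> cl2 x = 0%R <-> gam3 x.
Proof. exact: (sec_class_eq0 (S := absec2)). Qed.

Lemma cl2J x y : der x -> cl2 (x ^ y) = cl2 x.
Proof.
move=> dx; have -> : x ^ y = x * [~ x, y] by gnorm.
rewrite cl2M //; last exact: der_comm.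
suff -> : cl2 [~ x, y] = 0%R by rewrite GRing.addr0.
by apply/cl2_eq0; [apply: der_comm | apply: gam3_comm].
Qed.

(** Conjugation is trivial on G' / [G', G], so the commutator identities become bilinearity. *)
Lemma cl2Rl x x' y : cl2 [~ x * x', y] = (cl2 [~ x, y] + cl2 [~ x', y])%R.
Proof.
have -> : [~ x * x', y] = [~ x, y] ^ x' * [~ x', y] by gnorm.
rewrite cl2M ?cl2J //; [exact: der_comm | rewrite conjRg; exact: der_comm | exact: der_comm].
Qed.

Lemma cl2Rr x y y' : cl2 [~ x, y * y'] = (cl2 [~ x, y] + cl2 [~ x, y'])%R.
Proof.
have -> : [~ x, y * y'] = [~ x, y'] * [~ x, y] ^ y' by gnorm.
rewrite cl2M ?cl2J 1?GRing.addrC //; [exact: der_comm | exact: der_comm |].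
rewrite conjRg; exact: der_comm.
Qed.

Section Additive.
Variables (V : zmodType) (A : set G) (h : G -> V).
Hypotheses (sA : subgroup A) (hA : forall x y, A x -> A y -> h (x * y) = (h x + h y)%R).

Lemma addh1 : h 1 = 0%R.
Proof.
have A1 := subgroup1 sA.
by apply: (@GRing.addrI _ (h 1)); rewrite -hA // mulg1 GRing.addr0.
Qed.

Lemma addhV x : A x -> h x^-1 = (- h x)%R.
Proof.
move=> Ax; apply: (@GRing.addrI _ (h x)); rewrite -hA ?mulgV ?addh1 ?GRing.subrr //.
exact: subgroupV.
Qed.

Lemma addhX x n : A x -> h (x ^+ n) = (h x *+ n)%R.
Proof.
move=> Ax; elim: n => [|n IH]; first by rewrite addh1.
by rewrite expgS hA ?IH ?GRing.mulrS //; apply: subgroupX.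
Qed.

Lemma addh_preim E : zclosed E -> subgroup [set x | A x /\ E (h x)].
Proof.
move=> zE; apply: subgroupI; first by split; [apply: subgroup1 | rewrite addh1; case: zE].
move=> x y [Ax Ex] [Ay Ey]; have AVy := subgroupV sA Ay.
split; first exact: subgroupM.
by rewrite hA // addhV //; apply: (proj2 zE).
Qed.

Lemma addh_image B : subgroup B -> B `<=` A -> zclosed (h @` B).
Proof.
move=> sB BA; split; first by exists 1; [apply: subgroup1 | apply: addh1].
move=> _ _ [x Bx <-] [y By <-]; exists (x * y^-1).
  by apply: subgroupM => //; apply: subgroupV.
by rewrite hA ?addhV //; [apply: BA | apply: BA | apply: subgroupV => //; apply: BA].
Qed.

(** The position in [reps] of a representative of [h x] modulo E serves as the label of x. *)
Lemma addh_index E (reps : seq V) : zclosed E ->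
  (forall x, A x -> exists2 w, w \in reps & E (h x - w)%R) ->
  exists2 n, n <= size reps & has_index A [set x | A x /\ E (h x)] n.
Proof.
move=> zE hE; have sE := addh_preim zE.
case: reps hE => [|w0 reps] hE; first by have [] := hE 1 (subgroup1 sA).
have /choice[f fP] : forall x, exists i : 'I_(size (w0 :: reps)),
    A x -> E (h x - nth w0 (w0 :: reps) i)%R.
  move=> x; have [Ax|nA] := pselect (A x); last by exists ord0.
  have [w wr Ew] := hE x Ax; have iw : index w (w0 :: reps) < size (w0 :: reps).
    by rewrite index_mem.
  by exists (Ordinal iw) => _; rewrite /= nth_index.
have [||n nr hn] := @has_index_label G _ f A [set x | A x /\ E (h x)].
- move=> x y Ax Ay fxy; have AVx := subgroupV sA Ax; split; first exact: subgroupM.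
  rewrite hA // addhV //; have := fP x Ax; have := fP y Ay; rewrite fxy => Ey Ex.
  have := proj2 zE _ _ Ey Ex; rewrite GRing.opprB GRing.addrA GRing.subrK.
  by rewrite GRing.addrC.
- by [].
- by exists n => //; rewrite card_ord in nr.
Qed.

End Additive.

Lemma add_generates (V : zmodType) s (h : G -> V) E : generates s ->
  (forall x y, h (x * y) = (h x + h y)%R) -> zclosed E ->
  (forall x, x \in s -> E (h x)) -> forall x, E (h x).
Proof.
move=> gs hM zE hE x; suff [] : [set: G] x /\ E (h x) by [].
have hA : forall x y, [set: G] x -> [set: G] y -> h (x * y) = (h x + h y)%R by [].
by move: x; apply: (gs _ (addh_preim (subgroupT G) hA zE)) => y ys; split => //; apply: hE.
Qed.

Lemma zspan_min (V : zmodType) (E P : set V) l : zclosed P -> E `<=` P ->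
  (forall v, v \in l -> P v) -> zspan E l `<=` P.
Proof.
move=> zP; elim: l E => //= a l IH E EP lP; apply: IH; last first.
  by move=> v vl; apply: lP; rewrite in_cons vl orbT.
move=> v [c Ec]; rewrite -[v](GRing.subrK (a *~ c)%R).
by apply: zclosedD => //; [apply: EP | apply: zclosedMz => //; apply: lP; rewrite in_cons eqxx].
Qed.

Lemma zclosed0 (V : zmodType) : zclosed [set 0%R : V].
Proof. by split => // x y -> ->; rewrite GRing.subrr. Qed.

Lemma torsion_zclosed (V : zmodType) :
  zclosed [set v : V | exists2 k, 0 < k & (v *+ k)%R = 0%R].
Proof.
split; first by exists 1%N.
move=> u v [m m0 um] [n n0 vn]; exists (m * n)%N; first by rewrite muln_gt0 m0.
rewrite GRing.mulrnBl GRing.mulrnA um [in X in (_ - X)%R]mulnC GRing.mulrnA vn.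
by rewrite !GRing.mul0rn GRing.subrr.
Qed.

Lemma span1 s : generates s -> forall v, zspan [set 0%R] [seq cl1 x | x <- s] v.
Proof.
move=> gs v; have [x ->] := cl1_surj v; move: x.
apply: (add_generates gs); first exact: cl1M.
  exact/zspan_zclosed/zclosed0.
by move=> x xs; apply: zspan_mem; [apply: zclosed0 | apply: map_f].
Qed.

Lemma span2 s : generates s ->
  forall v, zspan [set 0%R] [seq cl2 [~ x, y] | x <- s, y <- s] v.
Proof.
move=> gs v; pose l := [seq cl2 [~ x, y] | x <- s, y <- s]; rewrite -/l.
have zl := zspan_zclosed l (zclosed0 (sec_quot absec2)).
have H x y : zspan [set 0%R] l (cl2 [~ x, y]).
  move: x; apply: (add_generates gs) => // [x x'|x xs]; first exact: cl2Rl.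
  move: y; apply: (add_generates gs) => // [y y'|y ys]; first exact: cl2Rr.
  by apply: zspan_mem; [apply: zclosed0 | apply/allpairsP; exists (x, y)].
have [x dx ->] := sec_class_surj v.
suff [] : [set x | der x /\ zspan [set 0%R] l (cl2 x)] x by [].
apply: der_sub dx; last by move=> y z; split; [apply: der_comm | apply: H].
by apply: addh_preim zl; [apply: der_subgroup | apply: cl2M].
Qed.

(** Among the powers of x with exponents 0 to n, two lie in one coset of H; the difference of the
    exponents divides n!. *)
Lemma power_mem A H n x : subgroup A -> subgroup H -> has_index A H n -> A x -> H (x ^+ n`!).
Proof.
move=> sA sH [t [_ tc _]] Ax.
have /choice[f fP] : forall k, exists i, H ((t i)^-1 * x ^+ k).
  by move=> k; apply: tc; apply: subgroupX.
have [i [j [ij fij]]] : exists i j : 'I_n.+1, i < j /\ f i = f j.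
  apply: contrapT => nij.
  have : #|'I_n.+1| <= #|'I_n|.
    apply: (@leq_card _ _ (fun i : 'I_n.+1 => f i)) => i j fij.
    have [ij|ij|/ord_inj//] := ltngtP i j; exfalso; apply: nij.
      by exists i, j.
    by exists j, i.
  by rewrite !card_ord ltnn.
have Hk : H (x ^+ (j - i)).
  have := fP i; have := fP j; rewrite fij => Hj Hi.
  have := subgroupVt sH (subgroupVl sH Hi) Hj.
  by rewrite -{1}(subnKC (ltnW ij)) expgnDr mulKg.
have /dvdnP[c ->] : j - i %| n`!.
  apply: dvdn_fact; rewrite subn_gt0 ij /= leq_subLR.
  by rewrite (leq_trans _ (leq_addl _ _)) // -ltnS.
by rewrite mulnC expgnA; apply: subgroupX.
Qed.

End LowerCentral.

(** * Torsion elements and their exponent *)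

Section Torsion.
Local Open Scope classical_set_scope.
Local Open Scope ring_scope.
Import GRing.Theory.

Definition torsion (V : zmodType) : set V := [set v | exists2 k, (0 < k)%N & v *+ k = 0].

Lemma torsionMn (V : zmodType) (v : V) k : (0 < k)%N -> torsion (v *+ k) -> torsion v.
Proof. by move=> k0 [m m0 vm]; exists (k * m)%N; rewrite ?muln_gt0 ?k0 // mulrnA. Qed.

Lemma torsionMz (V : zmodType) (v : V) c : c != 0 -> torsion (v *~ c) -> torsion v.
Proof.
case: c => n n0; first by apply: torsionMn; rewrite lt0n.
rewrite NegzE mulrNz => -[m m0 vm]; apply: (@torsionMn _ v n.+1) => //.
by exists m => //; apply: oppr_inj; rewrite -mulNrn vm oppr0.
Qed.

Lemma torsion_exponent (V : zmodType) (l : seq V) : (forall v, zspan [set 0] l v) ->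
  exists2 t, (0 < t)%N & forall v : V, torsion v -> v *+ t = 0.
Proof.
move=> lV; have [reps repsP] := zspan_torsion_finite l (zclosed0 V).
have /choice[k kP] : forall v : V, exists k, (0 < k)%N /\ (torsion v -> v *+ k = 0).
  move=> v; have [[k k0 vk]|nv] := pselect (torsion v); first by exists k.
  by exists 1%N.
exists (\prod_(v <- reps) k v)%N; first by rewrite big_seq prodn_cond_gt0 // => v _; case: (kP v).
move=> v tv; have [w wr /eqP] := repsP v (lV v) tv; rewrite subr_eq0 => /eqP vw.
rewrite -vw in wr; have [_ /(_ tv) kv] := kP v.
by rewrite (big_rem v) //= mulrnA kv mul0rn.
Qed.

End Torsion.

(** * Pulling torsion of the abelianisation back along an endomorphism *)

Section TorsionPullback.
Variable G : groupType.
Local Open Scope classical_set_scope.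
Local Open Scope group_scope.
Import GRing.Theory.
Variables (s : seq G) (f : G -> G) (e : nat).
Hypotheses (gs : generates s) (fM : mhom f) (e0 : 0 < e).
Hypothesis fe : forall x, exists y, f y = x ^+ e.

Local Notation V := (sec_quot (absec1 G)).
Local Notation cl := (@cl1 G).

Let F (v : V) : V := cl (f (sec_rep v)).

Let Fcl x : F (cl x) = cl (f x).
Proof.
have E : cl (sec_rep (cl x)) = cl x by apply: sec_repK.
have h : der ((sec_rep (cl x))^-1 * x) by apply/(sec_class_eq (S := absec1 G)).
by apply/(sec_class_eq (S := absec1 G)) => //; rewrite /= -mhomV // -fM; apply: der_hom.
Qed.

Let FD u v : F (u + v)%R = (F u + F v)%R.
Proof.
have [x ->] := cl1_surj u; have [y ->] := cl1_surj v.
by rewrite -cl1M !Fcl fM cl1M.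
Qed.

Let iF0 n : iter n F 0%R = 0%R.
Proof.
elim: n => //= n ->; apply: (@addrI _ (F 0%R)).
by rewrite -FD !addr0.
Qed.

Let iFD n u v : iter n F (u + v)%R = (iter n F u + iter n F v)%R.
Proof. by elim: n => //= n ->; rewrite FD. Qed.

Let iFMn n v k : iter n F (v *+ k)%R = (iter n F v *+ k)%R.
Proof. by elim: k => [|k IH]; rewrite ?mulr0n ?iF0 // !mulrS iFD IH. Qed.

Let iFMz n v c : iter n F (v *~ c)%R = (iter n F v *~ c)%R.
Proof.
case: c => k; first exact: iFMn.
rewrite NegzE !mulrNz; apply: (@addIr _ (iter n F (v *~ k.+1))%R).
by rewrite -iFD addNr iF0 [iter n F (v *~ k.+1)%R]iFMn addNr.
Qed.

Let iFtorsion n v : torsion v -> torsion (iter n F v).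
Proof. by move=> [k k0 vk]; exists k => //; rewrite -iFMn vk iF0. Qed.

(* Otherwise [z, f^-1 (z ^ e), f^-2 (z ^ e ^ 2), ...] would be independent modulo torsion. *)
Lemma torsion_pullback z : torsion (cl (f z)) -> torsion (cl z).
Proof.
move=> tfz; have [h hP] := choice fe; pose g i := iter i h z.
have gE i : iter i F (cl (g i)) = (cl z *+ (e ^ i))%R.
  elim: i => [|i IH] //; rewrite iterSr Fcl /= hP cl1X iFMn IH.
  by rewrite -mulrnA expnSr.
have [n [c cn0]] := zspan_relation (zclosed0 V) (fun i => span1 gs (cl (g i))).
rewrite big_ord_recr /= => E.
(* Apply F^n to the relation: for i < n the i-th term is a multiple of F^(n-i) (e^i cl z), which is
   torsion because F (cl z) is. Hence so is the last term, a nonzero multiple of cl z. *)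
have tn : torsion (iter n F (cl (g n) *~ c n)%R).
  have -> : (cl (g n) *~ c n)%R = (- \sum_(i < n) cl (g i) *~ c i)%R.
    by apply/eqP; rewrite -subr_eq0 opprK addrC; apply/eqP.
  have zT := torsion_zclosed V.
  suff : zspan [set v | torsion (iter n F v)] [::] (\sum_(i < n) cl (g i) *~ c i)%R.
    have : zclosed [set v | torsion (iter n F v)].
      split=> [|u v tu tv] /=; first by rewrite iF0; case: zT.
      rewrite iFD; apply: zclosedD => //.
      rewrite -mulrN1z iFMz; exact: zclosedMz.
    by move=> zz h'; apply: (zclosedN zz).
  rewrite /=; elim/big_ind: _ => [|u v /= tu tv|i _] /=; first by rewrite iF0; case: zT.
    by rewrite iFD; apply: zclosedD.
  rewrite iFMz; apply: zclosedMz => //.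
  have -> : iter n F (cl (g i)) = iter (n - i.+1) F (iter i.+1 F (cl (g i))).
    by rewrite -iterD subnK.
  apply: iFtorsion; rewrite iterS gE.
  rewrite -[F _]/(iter 1 F _) iFMn; apply: zclosedMn => //=.
  by rewrite Fcl.
rewrite iFMz gE in tn; apply: (@torsionMn _ _ (e ^ n)%N); first by rewrite expn_gt0 e0.
exact: torsionMz tn.
Qed.

End TorsionPullback.

(** * Chains of self-embeddings *)

Section Chain.
Variable G : groupType.
Local Open Scope classical_set_scope.
Local Open Scope group_scope.
Implicit Types (x y z g h u : G).
Variables (s : seq G) (phi : nat -> G -> G).
Hypotheses (gs : generates s) (phiM : forall n, mhom (phi n)).
Hypothesis phiI : forall n, injective (phi n).
Let Gam n := phi n @` [set: G].
Hypotheses (Gam_normal : forall n, normal_subgroup (Gam n)).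
Hypothesis (Gam_index : forall n, fin_index [set: G] (Gam n)).
Hypothesis (Gam_dec : forall m n, m <= n -> Gam n `<=` Gam m).

Local Notation V := (sec_quot (absec1 G)).
Local Notation W := (sec_quot (absec2 G)).

Let Gam_sub n : subgroup (Gam n). Proof. by case: (Gam_normal n). Qed.

Let Gam_power n : exists2 e, 0 < e & forall x, Gam n (x ^+ e).
Proof.
have [q Gq] := Gam_index n; exists q`!; first exact: fact_gt0.
by move=> x; apply: (power_mem (subgroupT G) (Gam_sub n) Gq).
Qed.

Let torsion_phi n z : torsion (cl1 (phi n z)) -> torsion (cl1 z).
Proof.
have [e e0 eP] := Gam_power n; apply: (torsion_pullback gs (phiM n) e0) => x.
by have [y _ fy] := eP x; exists y.
Qed.

(* [K] is the group of elements whose class in the abelianisation is a [t]-th multiple; it is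
   stable under endomorphisms and its torsion classes vanish. *)
Lemma comm_chain_der : exists n0, forall n g x, Gam n0 g ->
  exists2 u, der u & [~ phi n x, g] = phi n u.
Proof.
have [t t0 tP] := torsion_exponent (@span1 _ _ gs).
pose E : set V := [set w | exists v, w = (v *+ t)%R].
have zE : zclosed E.
  split; first by exists 0%R; rewrite GRing.mul0rn.
  by move=> _ _ [v ->] [w ->]; exists (v - w)%R; rewrite GRing.mulrnBl.
pose K := [set x : G | [set: G] x /\ E (cl1 x)].
have cl1A x y : [set: G] x -> [set: G] y -> cl1 (x * y) = (cl1 x + cl1 y)%R.
  by move=> _ _; apply: cl1M.
have sK : subgroup K := addh_preim (subgroupT G) cl1A zE.
have derK : @der G `<=` K.
  by move=> x /cl1_eq0 dx; split => //; rewrite dx; case: zE.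
have Kh (h : G -> G) : mhom h -> forall x, K x -> K (h x).
  move=> hM x [_ [v]]; have [y ->] := cl1_surj v; rewrite -cl1X => /cl1_eq xy.
  split => //; exists (cl1 (h y)); rewrite -cl1X; apply/cl1_eq.
  by rewrite -mhomV // -mhomX // -hM; apply: der_hom.
(* The quotient of the abelianisation by its t-th multiples is finitely generated and torsion, hence
   finite. *)
have [c Kc] : fin_index [set: G] K.
  have [reps repsP] := zspan_torsion_finite [seq cl1 x | x <- s] zE.
  have [x _|n _ Kn] := addh_index (subgroupT G) cl1A (reps := reps) zE; last by exists n.
  apply: repsP; last by exists t => //; exists (cl1 x).
  by apply: (zspan_mono (E := [set 0%R])) (span1 gs _) => _ ->; case: zE.
have KGam n : phi n @` K `<=` Gam n := iffRL (image_subset (@phiI n) K [set: G]) (@subsetT _ K).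
have nKn n : normal_subgroup (phi n @` K) := image_normal (phiM n) (@phiI n) (Gam_normal n) sK Kh.
(* The centraliser of phi_n(G) / phi_n(K) has index at most c ^ c for every n, so a single [n0]
   serves all n. *)
have [n0 n0P] := chain_stable (c ^ c) gs Gam_dec; exists n0 => n g x Gg.
have [sC [k kc Ck]] := centr_mod_index (Gam_normal n) (nKn n) (KGam n)
  (iffRL (image_has_index (phiM n) (@phiI n) _ _ _) Kc).
have sCG := subgroup_mulset sC (Gam_normal n).
have [m mk Jm] := has_index_leq_sub (subgroupT G) sCG sC
  (fun x Cx => mulsetl (Gam_sub n) Cx) (@subsetT _ _) Ck.
have [h Ch [y Gy gE]] := n0P _ n m sCG Jm (leq_trans mk kc) (fun x Gx => mulsetr sC Gx) _ Gg.
have [u Ku fu] : (phi n @` K) [~ phi n x, g].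
  have -> : [~ phi n x, g] = [~ phi n x, y] * [~ phi n x, h] ^ y by rewrite gE; gnorm.
  have [sKn nKn'] := nKn n; apply: subgroupM => //; last by apply: nKn'; apply: Ch; exists x.
  case: Gy => z _ <-; rewrite -mhomR //.
  by exists [~ x, z]; [apply: derK; apply: der_comm | ].
(* [phi n u] is a commutator, so the class of u is torsion; being a t-th multiple of a then torsion
   class, it vanishes. *)
exists u => //; have [_ [v uv]] := Ku.
have : torsion (cl1 u).
  apply: (@torsion_phi n); exists 1%N => //; rewrite fu GRing.mulr1n.
  by apply/cl1_eq0; apply: der_comm.
rewrite uv => /(torsionMn t0)/tP; rewrite -uv => /cl1_eq0 //.
Qed.


(** * The action of the chain by commutators modulo [G', G] *)

Section CommutatorAction.
Variables (n0 : nat) (delta : nat -> G -> G -> G).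
Hypothesis delta_der : forall n g x, Gam n0 g -> der (delta n g x).
Hypothesis deltaE : forall n g x, Gam n0 g -> [~ phi n x, g] = phi n (delta n g x).

Let A0 : set G := Gam n0.
Let sA0 : subgroup A0 := Gam_sub n0.

Lemma delta_mulr n g x y : A0 g ->
  cl2 (delta n g (x * y)) = (cl2 (delta n g x) + cl2 (delta n g y))%R.
Proof.
move=> Ag; have dx := delta_der n x Ag.
have -> : delta n g (x * y) = delta n g x ^ y * delta n g y.
  by apply: (@phiI n); rewrite phiM mhomJ // -!deltaE // phiM; gnorm.
rewrite cl2M ?cl2J //; last exact: delta_der.
by have [_] := der_normal G; apply.
Qed.

(** An additive map to an abelian group kills commutators. *)
Lemma delta_der0 n g u : A0 g -> der u -> cl2 (delta n g u) = 0%R.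
Proof.
move=> Ag; have hA : forall x y, [set: G] x -> [set: G] y ->
  cl2 (delta n g (x * y)) = (cl2 (delta n g x) + cl2 (delta n g y))%R.
  by move=> x y _ _; apply: delta_mulr.
move=> du; suff [] : [set: G] u /\ [set 0%R : W] (cl2 (delta n g u)) by [].
apply: (der_sub (addh_preim (subgroupT G) hA (zclosed0 W)) _ du) => x y; split => //=.
have hV z := addhV (subgroupT G) hA (x := z) I.
rewrite commgEl conjgE !(delta_mulr, hV) //.
by rewrite [(cl2 (delta n g x) + _)%R]GRing.addrC GRing.addKr GRing.addNr.
Qed.

(** The expansion of [phi_n x, gh] leaves a correction [delta n h (delta n g x)], whose class
    vanishes by [delta_der0]. *)
Lemma delta_mull n g h x : A0 g -> A0 h ->
  cl2 (delta n (g * h) x) = (cl2 (delta n g x) + cl2 (delta n h x))%R.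
Proof.
move=> Ag Ah; have dg := delta_der n x Ag.
have -> : delta n (g * h) x = delta n g x * delta n h (x * delta n g x).
  apply: (@phiI n); rewrite phiM -deltaE; last exact: subgroupM.
  by rewrite -!deltaE // phiM -deltaE //; gnorm.
rewrite cl2M //; last exact: delta_der.
by rewrite delta_mulr // (delta_der0 n Ah dg) GRing.addr0.
Qed.

Lemma delta_phi n x y : A0 (phi n y) -> delta n (phi n y) x = [~ x, y].
Proof. by move=> Ay; apply: (@phiI n); rewrite -deltaE // mhomR. Qed.

Local Notation E := {ffun 'I_(size s) -> W}.

(** By additivity in x, the values on the generators determine all classes [cl2 (delta n g x)]; the
    action of g thus becomes a vector in a finitely generated abelian group. *)
Let D n g : E := [ffun i : 'I_(size s) => cl2 (delta n g (nth 1 s i))].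
Let ad y : E := [ffun i : 'I_(size s) => cl2 [~ nth 1 s i, y]].

Let DM n g h : A0 g -> A0 h -> D n (g * h) = (D n g + D n h)%R.
Proof. by move=> Ag Ah; apply/ffunP => i; rewrite !ffunE delta_mull. Qed.

Let adM x y : ad (x * y) = (ad x + ad y)%R.
Proof. by apply/ffunP => i; rewrite !ffunE cl2Rr. Qed.

Let D_phi n y : A0 (phi n y) -> D n (phi n y) = ad y.
Proof. by move=> Ay; apply/ffunP => i; rewrite !ffunE delta_phi. Qed.

Let D_ext n g h : A0 g -> A0 h -> D n g = D n h ->
  forall x, cl2 (delta n g x) = cl2 (delta n h x).
Proof.
move=> Ag Ah /ffunP gh x; apply/eqP; rewrite -GRing.subr_eq0; apply/eqP; move: x.
apply: (add_generates gs _ (zclosed0 W)) => [x y|x xs].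
  by rewrite !delta_mulr // GRing.opprD GRing.addrACA.
have ix : index x s < size s by rewrite index_mem.
have := gh (Ordinal ix); rewrite !ffunE /= nth_index // => ->.
exact: GRing.subrr.
Qed.

Let E_span : exists l : seq E, forall v, zspan [set 0%R] l v.
Proof.
pose single (i : 'I_(size s)) (w : W) : E := [ffun j => if j == i then w else 0%R].
pose l2 : seq W := [seq cl2 [~ x, y] | x <- s, y <- s].
pose l := [seq single i w | i <- enum 'I_(size s), w <- l2].
have zl := zspan_zclosed l (zclosed0 E).
have H i w : zspan [set 0%R] l (single i w).
  apply: (zspan_min (P := [set w | zspan [set 0%R] l (single i w)])) (span2 gs w).
  - split => [|u v uP vP] /=.
      have -> : single i 0%R = 0%R by apply/ffunP => j; rewrite !ffunE; case: ifP.
      by case: zl.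
    have -> : single i (u - v)%R = (single i u - single i v)%R.
      by apply/ffunP => j; rewrite !ffunE; case: ifP; rewrite ?GRing.subr0.
    exact: (proj2 zl).
  - move=> _ -> /=; have -> : single i 0%R = 0%R by apply/ffunP => j; rewrite !ffunE; case: ifP.
    by case: zl.
  - move=> v vl; apply: zspan_mem; first exact: zclosed0.
    by apply/allpairsP; exists (i, v); rewrite mem_enum.
exists l => v.
have -> : v = (\sum_i single i (v i))%R.
  apply/ffunP => j; rewrite sum_ffunE (bigD1 j) //= ffunE eqxx big1 ?GRing.addr0 //.
  by move=> i ij; rewrite ffunE eq_sym (negPf ij).
elim/big_ind: _ => [|u w uP wP|i _]; [by case: zl | exact: zclosedD | exact: H].
Qed.

Let DX n g k : A0 g -> D n (g ^+ k) = (D n g *+ k)%R.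
Proof. exact: (addhX sA0 (@DM n)). Qed.

(** Some power of each element lies in Gam n, where [D n] agrees with [ad]. So [D n] is torsion
    modulo the image of [ad], and the number of torsion classes there does not depend on n. The
    preimage of that image has bounded index and contains Gam n, so it contains a fixed term of the
    chain. *)
Let D_ad : exists2 n1, n0 <= n1 & forall n g, n0 <= n -> Gam n1 g -> exists y, D n g = ad y.
Proof.
have zE := addh_image (subgroupT G) (fun x y _ _ => adM x y) (subgroupT G) (@subset_refl _ _).
have [l lP] := E_span; have [R RP] := zspan_torsion_finite l zE.
have [q Aq] := Gam_index n0.
have [n1 n1P] := chain_stable (q * size R) gs Gam_dec.
exists (maxn n0 n1) => [|n g n0n Gg]; first exact: leq_maxl.
have [e e0 eP] := Gam_power n.
have reps h : A0 h -> exists2 w, w \in R & (ad @` [set: G]) (D n h - w)%R.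
  move=> Ah; apply: RP; last first.
    exists e => //; have [y _ yE] := eP h; exists y => //.
    by rewrite -DX // -yE D_phi // yE; apply: subgroupX.
  by apply: zspan_mono (lP _) => _ ->; case: zE.
have [k kR Jk] := addh_index sA0 (@DM n) zE reps.
have sJ := addh_preim sA0 (@DM n) zE.
have Jm : has_index [set: G] [set x | A0 x /\ (ad @` [set: G]) (D n x)] (q * k).
  by apply: (has_index_mul (subgroupT G) sA0 _ _ Aq Jk) => // x [].
have JG : Gam n `<=` [set x | A0 x /\ (ad @` [set: G]) (D n x)].
  move=> x Gx; have Ax : A0 x by apply: Gam_dec Gx.
  by split => //; case: Gx Ax => y _ <- Ay; exists y; rewrite ?D_phi.
have [_ [y _ <-]] := n1P _ n _ sJ Jm (leq_mul (leqnn q) kR) JG g (Gam_dec (leq_maxr _ _) Gg).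
by exists y.
Qed.

(** The argument of [D_ad] with D_n(Gam m) as target. A bound independent of n and m is needed, so
    the representatives [R] come from the torsion of [E] itself. *)
Let D_deep n1 : n0 <= n1 -> (forall n g, n0 <= n -> Gam n1 g -> exists y, D n g = ad y) ->
  exists n2, forall n m g, n0 <= n -> n1 <= m -> n <= m -> Gam n2 g ->
    exists2 z, Gam m z & D n g = D n z.
Proof.
move=> n01 n1P; have [l lP] := E_span.
have [R RP] := zspan_torsion_finite l (zclosed0 E).
have [q Aq] := Gam_index n1.
have [n2 n2P] := chain_stable (q * size R) gs Gam_dec.
exists n2 => n m g n0n n1m nm Gg.
have Gm0 : Gam m `<=` A0 by apply: Gam_dec; apply: leq_trans n1m.
have G10 : Gam n1 `<=` A0 by apply: Gam_dec.
have zE := addh_image sA0 (@DM n) (Gam_sub m) Gm0.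
have D1 x y : Gam n1 x -> Gam n1 y -> D n (x * y) = (D n x + D n y)%R.
  by move=> /G10 Ax /G10 Ay; apply: DM.
have [e e0 eP] := Gam_power m.
have /choice[psi psiE] : forall x, exists y, phi m x = phi n y.
  by move=> x; have [|y _ <-] := @Gam_dec n m nm (phi m x); [exists x | exists y].
have psiM : mhom psi by move=> x y; apply: (@phiI n); rewrite -psiE !phiM !psiE.
(* If [D m h] = 0, then [delta m h] takes values in [G', G]; on e-th powers of generators
   [delta n h] is obtained from it through [psi], so e kills [D n h]. *)
have tors h : A0 h -> D m h = 0%R -> (D n h *+ e)%R = 0%R.
  move=> Ah Dh; apply/ffunP => i; rewrite ffunMnE !ffunE.
  have hA : forall x y, [set: G] x -> [set: G] y ->
    cl2 (delta n h (x * y)) = (cl2 (delta n h x) + cl2 (delta n h y))%R.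
    by move=> x y _ _; apply: delta_mulr.
  rewrite -(addhX (subgroupT G) hA) //.
  have [x _ xE] := eP (phi n (nth 1 s i)).
  have -> : delta n h (nth 1 s i ^+ e) = psi (delta m h x).
    by apply: (@phiI n); rewrite -psiE -!deltaE // mhomX // xE.
  apply/cl2_eq0; first by apply: der_hom => //; apply: delta_der.
  apply: gam3_hom => //; apply/cl2_eq0; first exact: delta_der.
  rewrite (@D_ext m h 1) //; first last.
  - by rewrite Dh (addh1 sA0 (@DM m)).
  - exact: subgroup1.
  exact: (addh1 sA0 (fun g h Ag Ah => @delta_mull m g h x Ag Ah)).
have reps h : Gam n1 h -> exists2 w, w \in R & (D n @` Gam m) (D n h - w)%R.
  move=> Gh; have Ah := G10 _ Gh.
  (* Dividing h by [phi m y], an element of Gam m, makes [D m] vanish, so what remains is torsion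
     under [D n]. *)
  have [y Dy] := n1P m h (leq_trans n01 n1m) Gh.
  have Gy : Gam m (phi m y) by exists y.
  have Ay := Gm0 _ Gy; have AVy := subgroupV sA0 Ay.
  have Ak : A0 ((phi m y)^-1 * h) by apply: subgroupM.
  have /(RP _ (lP _))[w wR /eqP] : exists2 k, 0 < k & (D n ((phi m y)^-1 * h) *+ k)%R = 0%R.
    exists e => //; apply: tors => //.
    by rewrite DM // (addhV sA0 (@DM m)) // D_phi // Dy GRing.addNr.
  rewrite GRing.subr_eq0 => /eqP Dw; exists w => //; exists (phi m y) => //.
  rewrite -Dw DM // (addhV sA0 (@DM n)) // GRing.opprD GRing.opprK GRing.addrCA.
  by rewrite GRing.subrr GRing.addr0.
have [k kR Jk] := addh_index (Gam_sub n1) D1 zE reps.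
have sJ := addh_preim (Gam_sub n1) D1 zE.
have Jm : has_index [set: G] [set x | Gam n1 x /\ (D n @` Gam m) (D n x)] (q * k).
  by apply: (has_index_mul (subgroupT G) (Gam_sub n1) _ _ Aq Jk) => // x [].
have JG : Gam m `<=` [set x | Gam n1 x /\ (D n @` Gam m) (D n x)].
  by move=> x Gx; split; [apply: Gam_dec Gx | exists x].
have [_ [z Gz <-]] := n2P _ m _ sJ Jm (leq_mul (leqnn q) kR) JG g Gg.
by exists z.
Qed.

(** By [D_deep], [phi n y] acts modulo [G', G] like some z in Gam m. Take u = [delta n z x]: its
    image [phi_n x, z] lies in the normal subgroup Gam m. *)
Lemma comm_gam3 : exists n, forall m x y, n <= m ->
  exists2 u, Gam m (phi n u) & gam3 (u^-1 * [~ x, y]).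
Proof.
have [n1 n01 n1P] := D_ad; have [n2 n2P] := D_deep n01 n1P.
exists (maxn n1 n2) => m x y nm; set n := maxn n1 n2 in nm *.
have n0n : n0 <= n by apply: leq_trans n01 (leq_maxl _ _).
have n1m : n1 <= m by apply: leq_trans (leq_maxl _ _) nm.
have Gy : Gam n (phi n y) by exists y.
have [z Gz Dz] := n2P n m _ n0n n1m nm (Gam_dec (leq_maxr _ _) Gy).
have Ay : A0 (phi n y) by apply: (Gam_dec n0n Gy).
have Az : A0 z by apply: (Gam_dec (leq_trans n01 n1m) Gz).
exists (delta n z x).
  rewrite -deltaE //; have [sG nG] := Gam_normal m.
  have -> : [~ phi n x, z] = (z^-1) ^ phi n x * z by gnorm.
  by apply: subgroupM => //; apply: nG; apply: subgroupV.
have dz := delta_der n x Az; have dzV := subgroupV (der_subgroup G) dz.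
apply/cl2_eq0; first by apply: (subgroupM (der_subgroup G) dzV); apply: der_comm.
rewrite cl2M //; last exact: der_comm.
rewrite (addhV (der_subgroup G) (@cl2M G)) // -(D_ext Ay Az Dz x) delta_phi //.
exact: GRing.addNr.
Qed.

End CommutatorAction.

(** Descend the series: if G' lies in Z and Z / W is central, then [G', G] lies in W, hence so does
    G', as G' is contained in X [G', G]. *)
Lemma central_series_der X Z : (forall x y, exists2 u, X u & gam3 (u^-1 * [~ x, y])) ->
  central_series [set: G] X Z -> @der G `<=` Z -> @der G `<=` X.
Proof.
move=> gX; elim=> // {}Z W' XW IH sW XsW ZW dZ; apply: IH.
apply: der_sub => // x y; have [u Xu gu] := gX x y.
rewrite -[[~ x, y]](mulKVg u); apply: subgroupM => //; first exact: XsW.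
apply: gam3_sub gu => // v z dv; apply: ZW => //; exact: dZ.
Qed.

Lemma comm_chain_cap : exists n, forall m x y, Gam m [~ phi n x, phi n y].
Proof.
have [n0 n0P] := comm_chain_der.
have /choice[dlt dltP] : forall t : nat * G * G, exists u, Gam n0 t.1.2 ->
    der u /\ [~ phi t.1.1 t.2, t.1.2] = phi t.1.1 u.
  move=> [[n g] x] /=; have [Ag|nA] := pselect (Gam n0 g); last by exists 1.
  by have [u du E] := n0P n g x Ag; exists u.
have [n nP] := @comm_gam3 n0 (fun n g x => dlt (n, g, x))
  (fun n g x Ag => (dltP (n, g, x) Ag).1) (fun n g x Ag => (dltP (n, g, x) Ag).2).
exists n => m x y; have [mn|/ltnW nm] := leqP m n.
  by apply: (Gam_dec mn); rewrite -mhomR //; exists [~ x, y].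
(* [psi] is phi_n^-1 phi_m, an embedding of G into itself with normal image phi_n^-1(Gam m); the
   self-embedding theorem applies to it. *)
have /choice[psi psiE] : forall x, exists y, phi m x = phi n y.
  by move=> z; have [|w _ <-] := @Gam_dec n m nm (phi m z); [exists z | exists w].
have psiM : mhom psi by move=> z w; apply: (@phiI n); rewrite -psiE !phiM !psiE.
have psiI : injective psi by move=> z w zw; apply: (@phiI m); rewrite !psiE zw.
have psiG u : (psi @` [set: G]) u <-> Gam m (phi n u).
  split=> [[z _ <-]|[z _]]; first by exists z => //; rewrite psiE.
  by rewrite psiE => /(@phiI n) <-; exists z.
have [sG nG] := Gam_normal m.
have nL : normal_subgroup (psi @` [set: G]).
  split; first by apply: image_subgroup => //; apply: subgroupT.
  by move=> u g /psiG Gu; apply/psiG; rewrite mhomJ //; apply: nG.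
have [_ [q]] := fin_index_mid (Gam_sub n) (Gam_dec nm) (@subsetT _ _) (Gam_sub m) (Gam_index m).
have -> : Gam m = phi n @` (psi @` [set: G]).
  apply/seteqP; split=> [_ [z _ <-]|_ [_ [z _ <-] <-]]; last by exists z; rewrite ?psiE.
  by exists (psi z) => //; exists z.
move/(image_has_index (phiM n) (@phiI n)) => Lq.
have cs := central_series_self_embedding gs psiM psiI nL Lq.
rewrite -mhomR //; exists [~ x, y] => //.
apply: (central_series_der _ cs (@subsetT _ _)); last exact: der_comm.
by move=> z w; have [u Gu gu] := nP m z w nm; exists u => //; apply/psiG.
Qed.

End Chain.

(** * Virtually abelian groups *)

Section FiniteIndex.
Variable G : groupType.
Local Open Scope classical_set_scope.
Local Open Scope group_scope.
Implicit Types (H : set G) (x y : G) (s : seq G).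

Lemma finite_indexP H : subgroup H -> finite_index H <-> fin_index [set: G] H.
Proof.
move=> sH; split=> [/finite_seqP[l lE]|[n [t [_ tc _]]]].
  have lP x : left_coset H x \in l.
    have : range (left_coset H) (left_coset H x) by exists x.
    by rewrite lE.
  (* The extra label is never taken; it only provides the successor bound that [inord] requires. *)
  have [|//|n _ ?] := @has_index_label G 'I_(size l).+1
    (fun x => inord (index (left_coset H x) l)) [set: G] H; last by exists n.
  move=> x y _ _ /(congr1 val) /=.
  rewrite !inordK ?ltnS ?index_size // => /(congr1 (nth set0 l)).
  by rewrite !nth_index // => /left_coset_eq; apply.
apply: (@sub_finite_set _ _ ((left_coset H \o t) @` [set: 'I_n])).
  by move=> _ [x _ <-]; have [i Hi] := tc x I; exists i => //; apply/left_coset_eq.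
exact/finite_image/finite_finset.
Qed.

Lemma finitely_generatedP : finitely_generated G -> exists s : seq G, generates s.
Proof.
move=> [S /finite_seqP[s ->] S1]; exists s => H sH sP x.
have : [set: G] x by []. rewrite -S1; apply; split => // y ys; exact: sP.
Qed.

(** The given map is multiplicative only on H; its inverse is a genuine endomorphism of G. *)
Lemma isomorphic_embedding H : subgroup H -> isomorphic H [set: G] -> exists f : G -> G,
  [/\ mhom f, injective f & range f = H].
Proof.
move=> sH [h [hH hI hS] hM].
have /choice[f fP] : forall y, exists x, H x /\ h x = y.
  by move=> y; have [x Hx <-] := hS y I; exists x.
have fK x : H x -> f (h x) = x.
  by move=> Hx; have [Hf hf] := fP (h x); apply: hI; rewrite ?inE.
exists f; split=> [x y|x y xy|].
- have [[Hx hx] [Hy hy]] := (fP x, fP y).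
  by rewrite -{1}hx -{1}hy -hM ?inE // fK //; apply: subgroupM.
- by rewrite -(fP x).2 xy; case: (fP y).
- by apply/seteqP; split=> [_ [x _ <-]|x Hx]; [case: (fP x) | exists (h x); rewrite ?fK].
Qed.

(** The centre of f(G) has finite index: an element of f(G) is determined modulo the centre by its
    commutators with the images of the generators, and these take finitely many values. *)
Lemma finite_commutators_virtually_abelian s (f : G -> G) (F : set G) :
  generates s -> mhom f -> fin_index [set: G] (range f) -> finite_set F ->
  (forall x y, F [~ f x, f y]) -> virtually_abelian G.
Proof.
move=> gs fM iA /finite_seqP[l lE] fF; pose A := range f.
have sA : subgroup A by apply: image_subgroup => //; apply: subgroupT.
pose H : set G := [set x | A x /\ forall y, commute (f y) x].
have sH : subgroup H.
  apply: subgroupI => [|x y [Ax Cx] [Ay Cy]].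
    by split; [apply: subgroup1 | move=> y; apply: commute1].
  split; first by apply: subgroupM => //; apply: subgroupV.
  by move=> z; apply: commuteM => //; apply: commuteV.
exists H; split=> //; last first.
  move=> x y /set_mem[[u _ <-] _] /set_mem[_ Cy]; exact: Cy.
apply/finite_indexP => //.
have HA : H `<=` A by move=> x [].
apply: (fin_index_trans (subgroupT G) sA (@subsetT _ _) HA iA).
(* With the inverse in the label, equal labels say that x^-1 y commutes with the generators, as left
   cosets require. *)
pose lab x : {ffun 'I_(size s) -> 'I_(size l).+1} :=
  [ffun i : 'I_(size s) => inord (index [~ f (nth 1 s i), x^-1] l)].
have [|//|n _ ?] := @has_index_label G _ lab A H; last by exists n.
move=> x y Ax Ay /ffunP xy; split; first by apply: subgroupM => //; apply: subgroupV.
have lP u z : A z -> [~ f u, z] \in l.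
  by move=> [v _ <-]; have := fF u v; rewrite lE.
apply: (gs [set z | commute (f z) (x^-1 * y)]) => [|z zs].
  apply: subgroupI => [|u v /= Cu Cv]; first by rewrite /= mhom1 //; apply/commute_sym/commute1.
  rewrite fM mhomV //; apply/commute_sym/commuteM; first exact: commute_sym.
  exact/commuteV/commute_sym.
have iz : index z s < size s by rewrite index_mem.
have /(congr1 val) := xy (Ordinal iz); rewrite !ffunE /= nth_index //.
rewrite !inordK ?ltnS ?index_size // => /(congr1 (nth 1 l)).
rewrite !nth_index; try by apply: lP; apply: subgroupV.
rewrite !commgEl => /mulgI zxy /=; apply/commgP; rewrite commgEl.
by rewrite conjgM zxy -conjgM mulVg conjg1 mulVg.
Qed.

End FiniteIndex.

Local Open Scope classical_set_scope.

Theorem corollary1p15 (G : groupType) (Gamma : nat -> set G)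
  (fgG : finitely_generated G)
  (Gamma_desc : forall n : nat, Gamma n.+1 `<=` Gamma n)
  (Gamma_normal : forall n : nat, normal_subgroup (Gamma n))
  (Gamma_index : forall n : nat, finite_index (Gamma n))
  (Gamma_iso : forall n : nat, isomorphic (Gamma n) [set: G])
  (Gamma_cap : finite_set (\bigcap_n Gamma n)) :
  virtually_abelian G.
Proof.
have [s gs] := finitely_generatedP fgG.
have /choice[phi phiP] : forall n, exists f : G -> G,
    [/\ mhom f, injective f & range f = Gamma n].
  by move=> n; apply: isomorphic_embedding => //; case: (Gamma_normal n).
have phiM n : mhom (phi n) by case: (phiP n).
have phiI n : injective (phi n) by case: (phiP n).
have phiE n : range (phi n) = Gamma n by case: (phiP n).
have Gfin n : fin_index [set: G] (Gamma n).
  by apply/finite_indexP; [case: (Gamma_normal n) | apply: Gamma_index].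
have Gdec m n : m <= n -> Gamma n `<=` Gamma m.
  elim: n => [|n IH]; first by rewrite leqn0 => /eqP ->.
  rewrite leq_eqVlt ltnS => /orP[/eqP -> //|/IH]; apply: subset_trans; exact: Gamma_desc.
have [|||n nP] := comm_chain_cap gs phiM phiI.
- by move=> n; rewrite phiE.
- by move=> n; rewrite phiE.
- by move=> m n; rewrite !phiE; apply: Gdec.
apply: (finite_commutators_virtually_abelian gs (phiM n) _ Gamma_cap).
  by rewrite phiE.
by move=> x y m _; rewrite -phiE; apply: nP.
Qed.
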